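(* Let $d\in\mathbb{R}$, let $f$ be a majority-type update function with parameters $m,\beta,\gamma$, and let the initial number of vertices with opinion $X$ be $X_0=n/2+d\sqrt{n}+o(\sqrt{n})$. Let $Z\stackrel{d}{=}\mathcal{N}\big(d,\tfrac{1}{4(\gamma^2-1)}\big)$. Then, as $n\to\infty$, $$\mathbb{P}\big(D_n(X_0)=X\big)=\mathbb{P}(Z\ge 0)+o(1)\quad\text{and}\quad \mathbb{P}\big(D_n(X_0)=Y\big)=\mathbb{P}(Z\le 0)+o(1).$$
   Context: Majority-type update function: a function $f:[0,1]\to[0,1]$ such that (i) $f$ is $(m+1)$-times continuously differentiable for some integer $m\ge 2$; (ii) $f$ is convex on $[0,1/2]$; (iii) $1-f(1-x)=f(x)$ for all $x\in[0,1]$; (iv) there exist $\gamma>1$ and $\beta>0$ such that, as $x\to0$, $f(x)=\beta x^m+O(x^{m+1})$ and $f(1/2+x)=1/2+\gamma x+O(x^2)$. The numbers $m,\beta,\gamma$ are called its parameters. Process: there are $n$ vertices, each holding opinion $X$ or $Y$. $X_t$ is the number of vertices with opinion $X$ after round $t$. The process $(X_t)_{t\in\mathbb{N}_0}$ (depending on $n$) is the Markov chain with deterministic initial value $X_0\in[0,n]$ (not required to be an integer) and, conditionally on $X_t$, $X_{t+1}\stackrel{d}{=}\mathrm{Bin}(n,f(X_t/n))$. Put $Y_t=n-X_t$. The eventually dominating opinion is $D_n(X_0)=X$ if $X_t=n$ for some $t$, and $D_n(X_0)=Y$ if $Y_t=n$ for some $t$. $\mathcal{N}(\mu,\sigma^2)$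 is the Gaussian distribution with mean $\mu$ and variance $\sigma^2$. *)

(* Defs.v *)
From HB Require Import structures.
From mathcomp Require Import all_boot all_order all_algebra.
From mathcomp Require Import all_classical all_reals all_analysis.
Set Implicit Arguments.
Unset Strict Implicit.
Unset Printing Implicit Defensive.
Import Order.TTheory GRing.Theory Num.Theory.
Import numFieldNormedType.Exports.
Local Open Scope classical_set_scope.
Local Open Scope ring_scope.

(* Only the values of [f] on [A] matter: [g k] is the [k]-th derivative of [f]
   relative to [A], so derivatives are one-sided at the endpoints of an
   interval. *)
Definition continuously_differentiable (R : realType) (k : nat) (A : set R)
    (f : R -> R) : Prop :=
  exists g : nat -> R -> R,
    [/\ {in A, g 0%N =1 f},
        forall i, (i < k)%N -> forall x, x \in A ->
          (g i y - g i x) / (y - x) @[y --> within A x^'] --> g i.+1 x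
      & {within A, continuous (g k)}].

(* A function [0,1] -> [0,1] is represented by a total function on [R] about
   which nothing is assumed outside [0,1]; in particular the expansion at 0
   is from the right. *)
Record majority_type (R : realType) (f : R -> R) (m : nat) (beta gamma : R)
    : Prop := MajorityType {
  majority_range : forall x, 0 <= x <= 1 -> 0 <= f x <= 1 ;
  majority_m_ge2 : (2 <= m)%N ;
  majority_smooth : continuously_differentiable m.+1 `[0, 1] f ;
  majority_convex : convex_function (`[0, 2^-1]%classic : set R) f ;
  majority_symmetric : forall x, 0 <= x <= 1 -> 1 - f (1 - x) = f x ;
  majority_gamma_gt1 : 1 < gamma ;
  majority_beta_gt0 : 0 < beta ;
  majority_expansion0 :
    (fun x => f x - beta * x ^+ m : R^o) =O_ (0^'+) (fun x => x ^+ m.+1 : R^o) ;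
  majority_expansion_half :
    (fun x => f (2^-1 + x) - (2^-1 + gamma * x) : R^o)
      =O_ (0 : R) (fun x => x ^+ 2 : R^o) }.

(* Markov chain with [X 0 = x0] a.s. and transitions x |-> Bin(n, f (x / n)),
   described by its finite-dimensional laws. The states are real because [x0]
   need not be an integer. *)
Definition binomial_chain (R : realType) (disp : measure_display)
    (T : measurableType disp) (P : probability T R) (n : nat) (f : R -> R)
    (x0 : R) (X : nat -> {RV P >-> R}) : Prop :=
  P [set w | X 0%N w = x0] = 1%E /\
  forall (t : nat) (x : nat -> R) (k : nat),
    P [set w | (forall s, (s <= t)%N -> X s w = x s) /\ X t.+1 w = k%:R]
    = (P [set w | forall s, (s <= t)%N -> X s w = x s]
       * binomial_prob n (f (x t / n%:R)%R) [set k])%E.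

Inductive opinion := OpX | OpY.

Definition supporters (R : realType) (n : nat) (o : opinion) (x : R) : R :=
  match o with OpX => x | OpY => n%:R - x end.

(* The event that [o] is the eventually dominating opinion. *)
Definition dominating (R : realType) (T : Type) (n : nat) (X : nat -> T -> R)
    (o : opinion) : set T :=
  [set w | exists t, supporters n o (X t w) = n%:R].

(* Main.v *)
Require Import Defs.
From HB Require Import structures.
From mathcomp Require Import all_boot all_order all_algebra.
From mathcomp Require Import all_classical all_reals all_analysis.
From mathcomp Require Import measurable_realfun.
From mathcomp Require Import ring lra.
Import Order.TTheory GRing.Theory Num.Theory.
Import numFieldNormedType.Exports.
Local Open Scope classical_set_scope.
Local Open Scope ring_scope.

(** Put w = (X - n/2) / sqrt n. Near the balanced state one round maps w to
    about gamma w plus a centred Gaussian noise of variance 1/4. Let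
    sigma^2 = 1/(4 (gamma^2 - 1)) and let H(w) = Phi(w / sigma) be the probability
    that w plus a centred Gaussian of variance sigma^2 is nonnegative. Since
    sigma^2 + 1/4 = gamma^2 sigma^2, the shifted profile w |-> H(w + c) is mapped
    by one idealized round to w |-> H(w + c / gamma). Hence after s rounds the
    expectation of H(W_s - c) is close to H(d - c / gamma^s), which tends to
    H(d) = P(Z >= 0): the Gaussian limit of W_s / gamma^s is read off from one
    family of test functions, and only the one-round statement needs a central
    limit argument.

    That argument is Lindeberg's replacement (binE_Psi). The function
    Psi(t, y) = Phi(y / sqrt t) solves the heat equation, so one Bernoulli trial
    of step h can be traded for an increase of the time variable by its
    variance, at a cost O(h^3) (heat_step); n trials with h = 1 / sqrt n cost
    O(1 / sqrt n) in total. The resulting bound for one round is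
    trans_normal_profile_bound, and iter_trans_normal_profile is its iteration.

    It remains to see that a large positive w is absorbed at n rather than
    at 0. Convexity makes f(1/2 + u) exceed 1/2 + u by at least a multiple of
    u (1/2 - u); near 1, where drift and noise both vanish, this drift is of the
    order of the variance. So, for a suitable constant A and all n at once,
    min(1, A / w^2), set to 1 for w <= 0, is a supermartingale
    (barrier_supermartingale). It equals 1 at the state 0, hence
    P(X_t = 0) <= E min(1, A / W_s^2) for all t >= s. As the barrier is at most
    1 - H(w - c) + e for some c depending on e (barrier_le_normal_profile), the
    two estimates give limsup P(X_t = 0) <= 1 - H(d) (extinction_bound).

    The symmetry of f turns this into the bound H(d) for P(X_t = n). Each round
    ends in 0 or n with probability at least 2^-n, so for fixed n absorption is
    almost sure and, for n large, each of the two opinions dominates with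
    probability at least its limiting value minus e; the two events being almost
    surely disjoint, both limits follow. *)

Set Implicit Arguments.
Unset Strict Implicit.
Unset Printing Implicit Defensive.

(** * Binomial expectations *)

Section binomial_expectation.
Context {R : realType}.
Implicit Types (p : R) (g : nat -> R).

Lemma binomial_pmfE n p k : binomial_pmf n p k = p ^+ k * (1 - p) ^+ (n - k) *+ 'C(n, k).
Proof. by []. Qed.

Definition binE p n g : R := \sum_(k < n.+1) binomial_pmf n p k * g k.

Lemma binE0 p g : binE p 0 g = g 0%N.
Proof.
by rewrite /binE big_ord1 /binomial_pmf bin0 expr0 subnn expr0 mulr1 mul1r.
Qed.

(** Splitting off the last trial: Pascal's rule in the form that lets every
    later estimate be proved by induction on the number of trials. *)
Lemma binE_recr p n g :
  binE p n.+1 g = binE p n (fun k => p * g k.+1 + (1 - p) * g k).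
Proof.
rewrite /binE.
under [LHS]eq_bigr do rewrite binomial_pmfE.
under [RHS]eq_bigr do rewrite binomial_pmfE.
set q := 1 - p.
rewrite [LHS]big_ord_recl /= /bump /=.
under [X in _ + X]eq_bigr => i _.
  rewrite add1n binS addnC mulrnDr mulrDl subSS; over.
under [RHS]eq_bigr => i _ do rewrite mulrDr.
rewrite !big_split /= addrCA; congr (_ + _).
  by apply: eq_bigr => i _; rewrite exprS -!mulrnAl -!mulrA; ring.
rewrite [X in _ + X]big_ord_recr [RHS]big_ord_recl /= (bin_small (ltnSn n)) mulr0n mul0r addr0.
congr (_ + _); first by rewrite !bin0 !subn0 !mulr1n !expr0 exprSr; ring.
apply: eq_bigr => i _; rewrite /bump /= add1n.
have -> : (n - i = (n - i.+1).+1)%N by rewrite -subSn ?ltn_ord// subSS.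
by rewrite -!(mulr_natr (_ * _)) [q ^+ _.+1]exprSr; ring.
Qed.

Lemma eq_binE p n g g' : (forall k, (k <= n)%N -> g k = g' k) ->
  binE p n g = binE p n g'.
Proof. by move=> gg'; apply: eq_bigr => k _; rewrite gg'// -ltnS. Qed.

Lemma binED p n g g' : binE p n (fun k => g k + g' k) = binE p n g + binE p n g'.
Proof. by rewrite /binE -big_split; apply: eq_bigr => k _; rewrite mulrDr. Qed.

Lemma binEZ p n c g : binE p n (fun k => c * g k) = c * binE p n g.
Proof. by rewrite /binE mulr_sumr; apply: eq_bigr => k _; rewrite mulrCA. Qed.

Lemma ler_binE p n g g' : 0 <= p <= 1 -> (forall k, (k <= n)%N -> g k <= g' k) ->
  binE p n g <= binE p n g'.
Proof.
move=> p01 gg'; apply: ler_sum => k _; apply: ler_wpM2l; first exact: binomial_pmf_ge0.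
by apply: gg'; rewrite -ltnS.
Qed.

Lemma binE_quad p n a b c :
  binE p n (fun k => a + b * k%:R + c * k%:R ^+ 2) =
  a + b * (n%:R * p) + c * (n%:R * p * (1 - p) + (n%:R * p) ^+ 2).
Proof.
elim: n a b c => [|n IHn] a b c; first by rewrite binE0; ring.
rewrite binE_recr.
transitivity (binE p n (fun k =>
    (a + b * p + c * p) + (b + 2 * c * p) * k%:R + c * k%:R ^+ 2)).
  by apply: eq_binE => k _; rewrite -natr1; ring.
by rewrite IHn -natr1; ring.
Qed.

Lemma binE_cst p n a : binE p n (fun=> a) = a.
Proof.
transitivity (binE p n (fun k => a + 0 * k%:R + 0 * k%:R ^+ 2)).
  by apply: eq_binE => k _; ring.
by rewrite binE_quad; ring.
Qed.

Lemma binE_le p n a g : 0 <= p <= 1 -> (forall k, (k <= n)%N -> g k <= a) ->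
  binE p n g <= a.
Proof. by move=> p01 ga; rewrite -[leRHS](binE_cst p n); exact: ler_binE. Qed.

Lemma binE_dist p n e g g' : 0 <= p <= 1 ->
  (forall k, (k <= n)%N -> `|g k - g' k| <= e k) ->
  `|binE p n g - binE p n g'| <= binE p n e.
Proof.
move=> p01 gg'.
have -> : binE p n g - binE p n g' = binE p n (fun k => g k - g' k).
  rewrite binED; congr (_ + _).
  by rewrite -mulN1r -binEZ; apply: eq_binE => k _; rewrite mulN1r.
apply: (le_trans (ler_norm_sum _ _ _)); apply: ler_sum => k _.
rewrite normrM ger0_norm ?binomial_pmf_ge0//.
by apply: ler_wpM2l; [exact: binomial_pmf_ge0|apply: gg'; rewrite -ltnS].
Qed.

(** One of p and 1 - p is at least 1/2. This gives absorption of the chain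
    without any lower bound on f. *)
Lemma binomial_pmf_extreme p n : 0 <= p <= 1 ->
  2^-1 ^+ n <= binomial_pmf n p 0 + binomial_pmf n p n.
Proof.
move=> /andP[p0 p1]; rewrite !binomial_pmfE bin0 binn subn0 subnn !mulr1n !expr0 mul1r mulr1.
have q0 : 0 <= 1 - p by rewrite subr_ge0.
have [ph|ph] := leP (2^-1) p.
  apply: (@le_trans _ _ (p ^+ n)); last by rewrite lerDr exprn_ge0.
  by apply: lerXn2r => //; rewrite nnegrE ?invr_ge0.
apply: (@le_trans _ _ ((1 - p) ^+ n)); last by rewrite lerDl exprn_ge0.
by apply: lerXn2r; rewrite ?nnegrE ?invr_ge0//; lra.
Qed.

(** Counting failures instead of successes. *)
Lemma binE_reflect p n g : binE (1 - p) n g = binE p n (fun k => g (n - k)%N).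
Proof.
rewrite /binE (reindex_inj rev_ord_inj) /=; apply: eq_bigr => k _.
have kn : (k <= n)%N by rewrite -ltnS.
rewrite subSS !binomial_pmfE bin_sub// subKn//.
by rewrite subKr [X in X *+ _]mulrC.
Qed.

Lemma binE_p0 k (g : nat -> R) : binE 0 k g = g 0%N.
Proof.
elim: k g => [|k IHk] g; first by rewrite binE0.
by rewrite binE_recr IHk mul0r add0r subr0 mul1r.
Qed.

Lemma binE_p1 k (g : nat -> R) : binE 1 k g = g k.
Proof. by rewrite -[X in binE X]subr0 binE_reflect binE_p0 subn0. Qed.

End binomial_expectation.

(** * The standard normal distribution function *)

Section gaussian.
Context {R : realType}.
Implicit Types x y z : R.
Local Notation mu := (@lebesgue_measure R).
Local Notation phi := (normal_pdf (0 : R) 1).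

Lemma std_pdfE x : phi x = normal_peak 1 * expR (- x ^+ 2 / 2).
Proof.
by rewrite normal_pdfE ?oner_neq0// /normal_fun subr0 expr1n.
Qed.

Lemma normal_peak1_le1 : normal_peak (1 : R) <= 1.
Proof.
have h1 : 1 <= 1 ^+ 2 * pi *+ 2 :> R by have := pi_ge2 R; rewrite expr1n; lra.
have h2 : 1 <= Num.sqrt (1 ^+ 2 * pi *+ 2) :> R.
  by rewrite -[leLHS]sqrtr1 ler_sqrt// (le_trans ler01).
by rewrite /normal_peak invf_le1// (lt_le_trans ltr01).
Qed.

(** From 1 + y <= exp y with y = x^2 / 2; this yields all the bounds on the
    derivatives of the density. *)
Lemma poly_gauss_le1 x k : 0 <= k -> k <= 1 + x ^+ 2 / 2 -> k * phi x <= 1.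
Proof.
move=> k0 kx; rewrite std_pdfE mulNr expRN mulrCA.
rewrite -[leRHS]mulr1 ler_pM ?normal_peak_ge0 ?normal_peak1_le1//.
  by rewrite mulr_ge0// invr_ge0 expR_ge0.
rewrite ler_pdivrMr ?expR_gt0// mul1r (le_trans kx)//.
exact: expR_ge1Dx.
Qed.

Lemma std_pdf_le1 x : phi x <= 1.
Proof.
rewrite -[phi x]mul1r; apply: poly_gauss_le1 => //.
by rewrite lerDl mulr_ge0 ?sqr_ge0// invr_ge0.
Qed.

Lemma x_std_pdf_le1 x : `|x * phi x| <= 1.
Proof.
rewrite normrM (ger0_norm (normal_pdf_ge0 _ _ _)); apply: poly_gauss_le1 => //.
rewrite -[x ^+ 2]ger0_norm ?sqr_ge0// normrX.
by have := sqr_ge0 (`|x| - 1); rewrite sqrrB; lra.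
Qed.

Lemma is_derive_std_pdf x : is_derive x 1 phi (- x * phi x).
Proof.
have -> : (phi : R -> R) = (fun y => normal_peak 1 * expR (- y ^+ 2 / 2)).
  by apply/funext => y; rewrite std_pdfE.
apply: is_derive_eq.
rewrite /GRing.scale /= /GRing.scale /=.
by field.
Qed.

Lemma is_derive_x_std_pdf x :
  is_derive x 1 (fun y => - y * phi y) ((x ^+ 2 - 1) * phi x).
Proof.
have H := is_derive_std_pdf x.
apply: is_derive_eq.
by rewrite /GRing.scale /=; ring.
Qed.

Definition Phi z : R := \int[mu]_(t in `]-oo, z]) phi t.

Lemma integrable_std_pdf (A : set R) : measurable A ->
  mu.-integrable A (EFin \o phi).
Proof.
by move=> mA; apply: (integrableS _ _ (subsetT _)) => //; exact: integrable_normal_pdf.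
Qed.

Lemma PhiE z : (Phi z)%:E = normal_prob 0 1 `]-oo, z]%classic.
Proof. by rewrite /Phi /Rintegral fineK//; exact: (@fin_num_measure _ _ _ (normal_prob 0 1)). Qed.

Lemma is_derive_Phi z : is_derive z 1 Phi (phi z).
Proof.
have [d1 d2] : derivable Phi z 1 /\ (Phi^`())%classic z = phi z.
  apply: (@continuous_FTC1 R phi -oo%O z (z + 1)).
  - by rewrite ltrDl.
  - exact: integrable_std_pdf.
  - exact: ltNyr.
  - by apply: continuous_normal_pdf; rewrite oner_neq0.
by apply: DeriveDef; [exact: d1|rewrite -derive1E; exact: d2].
Qed.

Lemma Phi_ge0 z : 0 <= Phi z.
Proof. by rewrite -lee_fin PhiE; exact: (@measure_ge0 _ _ _ (normal_prob 0 1)). Qed.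

Lemma Phi_le1 z : Phi z <= 1.
Proof. by rewrite -lee_fin PhiE; exact: (@probability_le1 _ _ _ (normal_prob 0 1)). Qed.

Lemma Phi_nondecreasing : {homo Phi : x y / x <= y}.
Proof.
move=> x y xy; rewrite -lee_fin !PhiE.
by apply: (@le_measure _ _ _ (normal_prob 0 1)); rewrite ?inE//; exact: subitvPr.
Qed.

Lemma Phi_opp z : Phi (- z) = 1 - Phi z.
Proof.
apply/eqP; rewrite -subr_eq opprK addrC; apply/eqP/EFin_inj.
rewrite EFinD !PhiE /normal_prob.
have mphi (A : set R) : measurable_fun A (fun x => (phi x)%:E).
  by apply/measurable_EFinP/measurable_funTS; exact: measurable_normal_pdf.
rewrite (@ge0_integration_by_substitutionNy R phi z).
- have -> : (\int[mu]_(x in `[z, +oo[) ((phi \o -%R) x)%:E =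
             \int[mu]_(x in `]z, +oo[) (phi x)%:E)%E.
    rewrite integral_itv_obnd_cbnd; last exact: mphi.
    by apply: eq_integral => x _ /=; rewrite !std_pdfE sqrrN.
  have <- : normal_prob (0 : R) 1 setT = 1%E.
    exact: (probability_setT (normal_prob 0 1)).
  have <- : `]-oo, z] `|` `]z, +oo[ = setT.
    rewrite -subTset => x _ /=; rewrite !in_itv /= andbT.
    by case: (leP x z) => ?; [left|right].
  rewrite /normal_prob (ge0_integral_setU mu) //=.
  + exact: mphi.
  + by move=> x _; rewrite lee_fin normal_pdf_ge0.
  + apply/disj_setPS => x [] /=; rewrite !in_itv /= andbT => xz zx.
    by have := le_lt_trans xz zx; rewrite ltxx.
- by apply: continuous_subspaceT; apply: continuous_normal_pdf; rewrite oner_neq0.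
- by move=> x _; exact: normal_pdf_ge0.
Qed.

Lemma Phi_small e : 0 < e -> exists K, Phi (- K) <= e.
Proof.
move=> e0.
pose F n := (`]-oo, (- n%:R)%R]%classic : set R).
have : normal_prob 0 1 (F n) @[n --> \oo] --> normal_prob (0 : R) 1 (\bigcap_n F n).
  apply: (@nonincreasing_cvg_mu _ _ _ (normal_prob 0 1)) => //=.
  - by rewrite (le_lt_trans (probability_le1 (normal_prob 0 1) _)) ?ltry//; exact: measurable_itv.
  - by move=> i; exact: measurable_itv.
  - by apply: bigcap_measurableType => i _; exact: measurable_itv.
  - move=> m n mn; apply/subsetPset => x; rewrite /F /= !in_itv /= => /le_trans; apply.
    by rewrite lerN2 ler_nat.
have -> : \bigcap_n F n = set0.
  rewrite -subset0 => t /(_ (Num.trunc (- t)).+1 I).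
  by rewrite /F/= in_itv/= leNgt => /negP; apply; rewrite ltrNl; exact: truncnS_gt.
rewrite (@measure0 _ _ _ (normal_prob 0 1)) => /fine_cvgP[_] /cvgr0_norm_le /(_ e e0).
case=> N _ /(_ N (leqnn _)) /=; rewrite -PhiE /= ger0_norm ?Phi_ge0// => h.
by exists N%:R.
Qed.

(** The change of variables z = (d - x) / s, which also reflects the half-line. *)
Lemma normal_prob_ge0 (d s : R) : 0 < s ->
  normal_prob d s `[0, +oo[%classic = (Phi (d / s))%:E.
Proof.
move=> s0; rewrite PhiE /normal_prob.
pose F x := (d - x) / s.
have dF x : is_derive x 1 F (- s^-1).
  rewrite /F; apply: is_derive_eq; rewrite /GRing.scale /=; ring.
have F'E : (F^`())%classic = cst (- s^-1).
  by apply/funext => x; rewrite derive1E derive_val.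
have FE : d / s = F 0 by rewrite /F subr0.
have cF : continuous F.
  by move=> x; apply/differentiable_continuous/derivable1_diffP.
have pdfE x : normal_pdf d s x = phi (F x) * s^-1.
  rewrite std_pdfE normal_pdfE ?gt_eqF// /normal_fun /F.
  rewrite /normal_peak expr1n mul1r -(mulrnAr (s ^+ 2)) sqrtrM ?sqr_ge0//.
  rewrite sqrtr_sqr gtr0_norm// invfM [RHS]mulrAC (mulrC s^-1).
  by congr (_ * expR _); field; rewrite gt_eqF.
rewrite FE (@decreasing_ge0_integration_by_substitutiony R F phi 0).
- by apply: eq_integral => x _; rewrite pdfE F'E !fctE opprK.
- by move=> x y _ _ xy; rewrite /F ltr_pM2r ?invr_gt0// ltrD2l ltrN2.
- by rewrite F'E => x _; exact: cvg_cst.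
- by rewrite F'E; exact: is_cvg_cst.
- by rewrite F'E; exact: is_cvg_cst.
- split; first by move=> x _.
  by apply: cvg_at_right_filter; exact: cF.
- apply/cvgrNyPle => A.
  near=> x; rewrite /F ler_pdivrMr// lerBlDr -lerBlDl; near: x.
  by exists (d - A * s); split; [rewrite num_real|move=> x /ltW].
- by apply: continuous_subspaceT; apply: continuous_normal_pdf; rewrite oner_neq0.
- by move=> x _; exact: normal_pdf_ge0.
Unshelve. all: by end_near. Qed.

Lemma normal_prob_le0 (d s : R) : 0 < s ->
  normal_prob d s `]-oo, 0]%classic = (1 - Phi (d / s))%:E.
Proof.
move=> s0; have mpdf (A : set R) : measurable_fun A (fun x => (normal_pdf d s x)%:E).
  by apply/measurable_EFinP/measurable_funTS; exact: measurable_normal_pdf.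
have tail : normal_prob d s `]0, +oo[%classic = (Phi (d / s))%:E.
  by rewrite -normal_prob_ge0// /normal_prob integral_itv_obnd_cbnd//; exact: mpdf.
have -> : `]-oo, 0]%classic = ~` `]0, +oo[%classic :> set R.
  by apply/seteqP; split=> x /=; rewrite !in_itv /= andbT leNgt => /negP.
by rewrite (@probability_setC _ _ _ (normal_prob d s))// [X in (1 - X)%E]tail.
Qed.

End gaussian.

(** * The heat equation and Lindeberg's replacement *)

Section heat.
Context {R : realType}.
Implicit Types (a b c x y z r s t T p q h : R).
Local Notation phi := (normal_pdf (0 : R) 1).

Lemma norm_le_derive (f df : R -> R) M a b : a <= b ->
  (forall x, a <= x <= b -> is_derive x 1 f (df x)) ->
  (forall x, a <= x <= b -> `|df x| <= M) ->
  `|f b - f a| <= M * (b - a).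
Proof.
move=> ab fdf dfM.
have [x xab|x xab|x] := @MVT_segment R f df a b ab.
- by apply: fdf; move: xab; rewrite in_itv /= => /andP[/ltW -> /ltW ->].
- apply: derivable_within_continuous => y; rewrite in_itv /= => yab.
  by have [] := fdf y yab.
- rewrite in_itv /= => xab ->.
  by rewrite normrM (ger0_norm (_ : 0 <= b - a)) ?subr_ge0// ler_wpM2r ?subr_ge0// dfM.
Qed.

Lemma lipschitz_derive (f df : R -> R) M :
  (forall x, is_derive x 1 f (df x)) -> (forall x, `|df x| <= M) ->
  forall a b, `|f a - f b| <= M * `|a - b|.
Proof.
move=> fdf dfM a b; have [ab|/ltW ba] := leP a b.
  rewrite distrC (distrC a) (ger0_norm (_ : 0 <= b - a)) ?subr_ge0//.
  by apply: norm_le_derive => // x _; exact: dfM.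
rewrite (ger0_norm (_ : 0 <= a - b)) ?subr_ge0//.
by apply: norm_le_derive => // x _; exact: dfM.
Qed.

Lemma Phi_lipschitz a b : `|Phi a - Phi b| <= `|a - b|.
Proof.
rewrite -[leRHS]mul1r; apply: lipschitz_derive; first exact: is_derive_Phi.
by move=> x; rewrite ger0_norm ?normal_pdf_ge0// std_pdf_le1.
Qed.

Lemma x_std_pdf_lipschitz a b : `|a * phi a - b * phi b| <= 2 * `|a - b|.
Proof.
have := lipschitz_derive is_derive_x_std_pdf (M := 2).
move=> /(_ _ a b); rewrite !mulNr -opprD normrN; apply => x.
rewrite normrM (ger0_norm (normal_pdf_ge0 _ _ _)).
rewrite -[leRHS]mulr1 -ler_pdivrMl// mulrA; apply: poly_gauss_le1.
  by rewrite mulr_ge0// invr_ge0.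
rewrite ler_pdivrMl// (le_trans (ler_normB _ _))// normr1 ger0_norm ?sqr_ge0//.
by have := sqr_ge0 x; lra.
Qed.

(** The probability that y plus a centred Gaussian of variance t is
    nonnegative; as a function of (t, y) it solves the heat equation
    Psi_t = Psi_yy / 2. *)
Definition Psi t y := Phi (y / Num.sqrt t).

Lemma Psi_lipschitz s t y z : 0 < s -> s ^+ 2 <= t ->
  `|Psi t y - Psi t z| <= `|y - z| / s.
Proof.
move=> s0 st; have s_t : s <= Num.sqrt t.
  by rewrite -[s]gtr0_norm// -sqrtr_sqr ler_wsqrtr.
apply: (le_trans (Phi_lipschitz _ _)).
rewrite -mulrBl normrM ler_wpM2l// normfV ger0_norm ?sqrtr_ge0//.
by rewrite lef_pV2// posrE (lt_le_trans s0).
Qed.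

(** The parabola is the path followed when a trial of step r is traded for the
    variance c r^2 of that trial. *)
Lemma is_derive_Psi_curve T c y a r : 0 < T - c * r ^+ 2 ->
  is_derive r 1 (fun r => Psi (T - c * r ^+ 2) (y + a * r))
    (let s := Num.sqrt (T - c * r ^+ 2) in let z := (y + a * r) / s in
     phi z * a / s + z * phi z * (c * r) / s ^+ 2).
Proof.
move=> t0; cbv zeta; set s := Num.sqrt (T - c * r ^+ 2); set z := (y + a * r) / s.
have s0 : s != 0 by rewrite gt_eqF// sqrtr_gt0.
pose t r := T - c * r ^+ 2.
have dt : is_derive r 1 t (- (2 * c * r)).
  by rewrite /t; apply: is_derive_eq; rewrite /GRing.scale /=; ring.
have ds : is_derive r 1 (Num.sqrt \o t) ((2 * s)^-1 * - (2 * c * r)).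
  by apply: is_derive1_comp; exact: is_derive1_sqrt.
have dsV : is_derive r 1 (fun r => (Num.sqrt (t r))^-1)
     (- s ^- 2 *: ((2 * s)^-1 * - (2 * c * r))).
  exact: (@is_deriveV _ (Num.sqrt \o t)).
have dz : is_derive r 1 (fun r => (y + a * r) * (Num.sqrt (t r))^-1)
    (a / s + z * (c * r) / s ^+ 2).
  apply: is_derive_eq; rewrite /GRing.scale /= -/s /z.
  by field.
have -> : phi z * a / s + z * phi z * (c * r) / s ^+ 2 =
    phi z * (a / s + z * (c * r) / s ^+ 2) by field.
exact: (@is_derive1_comp _ Phi (fun r => (y + a * r) / Num.sqrt (t r)) r _ _ (is_derive_Phi z) dz).
Qed.

(** The left side is the derivative, in the step r, of the expectation of Psi
    after one trial, the time running backwards by the variance of the trial.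
    The heat equation cancels its first-order part: the increment of phi
    between the two outcomes is an intermediate value of phi' times r / s, and
    it is compared with the mean of phi' at these outcomes. *)
Lemma heat_flux p q s r z1 z2 : 0 < s -> 0 <= p -> 0 <= q -> p + q = 1 ->
  0 <= r -> z1 - z2 = r / s ->
  `|p * (phi z1 * q / s + z1 * phi z1 * (p * q * r) / s ^+ 2)
    + q * (phi z2 * - p / s + z2 * phi z2 * (p * q * r) / s ^+ 2)|
  <= 2 * r ^+ 2 / s ^+ 3.
Proof.
move=> s0 p0 q0 pq r0 zB.
have sne : s != 0 by rewrite gt_eqF.
have rs0 : 0 <= r / s by rewrite divr_ge0// ltW.
have zle : z2 <= z1 by rewrite -subr_ge0 zB.
have [x] : exists2 x, x \in `[z2, z1] & phi z1 - phi z2 = - x * phi x * (z1 - z2).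
  apply: (@MVT_segment R phi (fun x => - x * phi x)) => //.
    by move=> x _; exact: is_derive_std_pdf.
  by apply: continuous_subspaceT; apply: continuous_normal_pdf; rewrite oner_neq0.
rewrite in_itv /= => /andP[xl xu] gx.
have -> : p * (phi z1 * q / s + z1 * phi z1 * (p * q * r) / s ^+ 2)
    + q * (phi z2 * - p / s + z2 * phi z2 * (p * q * r) / s ^+ 2) =
    p * q * r / s ^+ 2 *
    (p * (z1 * phi z1 - x * phi x) + q * (z2 * phi z2 - x * phi x)).
  (* the first summand is the transport term, the second one the time derivative *)
  transitivity (p * q / s * (phi z1 - phi z2)
    + p * q * r / s ^+ 2 * (p * (z1 * phi z1) + q * (z2 * phi z2))); first by field.
  rewrite gx zB.
  have -> : p * (z1 * phi z1 - x * phi x) + q * (z2 * phi z2 - x * phi x) =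
    p * (z1 * phi z1) + q * (z2 * phi z2) - (p + q) * (x * phi x) by ring.
  by rewrite pq; field.
have x1 : `|z1 * phi z1 - x * phi x| <= 2 * (r / s).
  apply: (le_trans (x_std_pdf_lipschitz _ _)); rewrite ler_pM2l//.
  by rewrite ger0_norm ?subr_ge0// -zB lerD2l lerN2.
have x2 : `|z2 * phi z2 - x * phi x| <= 2 * (r / s).
  apply: (le_trans (x_std_pdf_lipschitz _ _)); rewrite ler_pM2l//.
  by rewrite ler0_norm ?subr_le0// -zB opprB lerD2r.
have c0 : 0 <= p * q * r / s ^+ 2 by rewrite divr_ge0 ?exprn_ge0 ?mulr_ge0// ltW.
have -> : 2 * r ^+ 2 / s ^+ 3 = r / s ^+ 2 * (2 * (r / s)) by field.
rewrite normrM (ger0_norm c0); apply: ler_pM => //.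
  apply: ler_wpM2r; first by rewrite invr_ge0 exprn_ge0// ltW.
  by rewrite -[leRHS]mul1r ler_wpM2r// mulr_ile1//; lra.

rewrite (le_trans (ler_normD _ _))// !normrM (ger0_norm p0) (ger0_norm q0).
have -> : 2 * (r / s) = p * (2 * (r / s)) + q * (2 * (r / s)).
  by rewrite -mulrDl pq mul1r.
by apply: lerD; apply: ler_wpM2l.
Qed.

(** Integrate heat_flux from the step 0, where both sides agree, to h. *)
Lemma heat_step s p t y h : 0 < s -> s ^+ 2 <= t -> 0 <= p <= 1 -> 0 <= h ->
  `|p * Psi t (y + (1 - p) * h) + (1 - p) * Psi t (y - p * h)
    - Psi (t + p * (1 - p) * h ^+ 2) y| <= 2 * h ^+ 3 / s ^+ 3.
Proof.
move=> s0 st /andP[p0 p1] h0.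
have [q qE] : exists q, q = 1 - p by exists (1 - p).
have q0 : 0 <= q by rewrite qE subr_ge0.
have pq : p + q = 1 by rewrite qE; ring.
rewrite -qE; have {qE} [T TE] : exists T, T = t + p * q * h ^+ 2 by eexists.
rewrite -TE; have [J JE] : exists J : R -> R, J = fun r =>
    p * Psi (T - p * q * r ^+ 2) (y + q * r)
    + q * Psi (T - p * q * r ^+ 2) (y + - p * r) by eexists.
have -> : p * Psi t (y + q * h) + q * Psi t (y - p * h) = J h.
  by rewrite JE TE addrK mulNr.
have -> : Psi T y = J 0.
  by rewrite JE expr0n /= !mulr0 subr0 !addr0 -mulrDl pq mul1r.
have t_ge r : 0 <= r <= h -> s ^+ 2 <= T - p * q * r ^+ 2.
  move=> /andP[r0 rh]; apply: (le_trans st); rewrite TE -addrA lerDl -mulrBr.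
  by rewrite mulr_ge0 ?mulr_ge0// subr_ge0 lerXn2r.
have -> : 2 * h ^+ 3 / s ^+ 3 = 2 * h ^+ 2 / s ^+ 3 * (h - 0) by rewrite subr0; ring.
pose dJ r := let s := Num.sqrt (T - p * q * r ^+ 2) in
  let z1 := (y + q * r) / s in let z2 := (y + - p * r) / s in
  p * (phi z1 * q / s + z1 * phi z1 * (p * q * r) / s ^+ 2)
    + q * (phi z2 * - p / s + z2 * phi z2 * (p * q * r) / s ^+ 2).
apply: (@norm_le_derive J dJ _ _ _ h0) => r rh.
  have tr0 : 0 < T - p * q * r ^+ 2 by rewrite (lt_le_trans _ (t_ge _ rh))// exprn_gt0.
  have d1 := is_derive_Psi_curve y q tr0.
  have d2 := is_derive_Psi_curve y (- p) tr0.
  by rewrite JE; apply: is_derive_eq.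
have s_sr : s <= Num.sqrt (T - p * q * r ^+ 2).
  by rewrite -[s]gtr0_norm// -sqrtr_sqr ler_wsqrtr// t_ge.
rewrite {}/dJ; move: s_sr; cbv zeta; set sr := Num.sqrt _; move: sr => sr s_sr.
have sr0 : 0 < sr by rewrite (lt_le_trans s0).
have /andP[r0 rleh] := rh.
apply: (@le_trans _ _ (2 * r ^+ 2 / sr ^+ 3)).
  apply: heat_flux => //; rewrite -mulrBl; congr (_ / _).
  by rewrite -[RHS]mul1r -pq; ring.
apply: ler_pM.
- by rewrite mulr_ge0 ?exprn_ge0.
- by rewrite invr_ge0 exprn_ge0// ltW.
- by rewrite ler_pM2l// lerXn2r.
- by rewrite lef_pV2 ?posrE ?exprn_gt0// lerXn2r ?nnegrE// ltW.
Qed.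

Lemma Psi_time_lipschitz s t t' y : 0 < s -> s ^+ 2 <= t -> s ^+ 2 <= t' ->
  `|Psi t y - Psi t' y| <= `|t - t'| / s ^+ 2.
Proof.
move=> s0; wlog tt' : t t' / t <= t'.
  move=> H st st'; have [tt'|/ltW tt'] := leP t t'; first exact: H.
  by rewrite distrC (distrC t); exact: H.
move=> st st'; rewrite distrC (distrC t) (ger0_norm (_ : 0 <= t' - t)) ?subr_ge0//.
rewrite mulrC; pose df x := - (y / Num.sqrt x * phi (y / Num.sqrt x)) / (2 * x).
apply: (@norm_le_derive (Psi ^~ y) df) => // x /andP[tx xt'].
  have x0 : 0 < x by rewrite (lt_le_trans (exprn_gt0 2 s0))// (le_trans st).
  have sx0 : Num.sqrt x != 0 by rewrite gt_eqF// sqrtr_gt0.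
  have ds := is_derive1_sqrt x0.
  have dsV := is_deriveV sx0 ds.
  have dz : is_derive x 1 (fun x => y * (Num.sqrt x)^-1)
      (- (y / Num.sqrt x) / (2 * x)).
    apply: is_derive_eq; rewrite /GRing.scale /=.
    have -> : - (y / Num.sqrt x) / (2 * x) = - (y / Num.sqrt x) / (2 * Num.sqrt x ^+ 2).
      by rewrite (sqr_sqrtr (ltW x0)).
    by field.
  have -> : df x = phi (y / Num.sqrt x) * (- (y / Num.sqrt x) / (2 * x)).
    by rewrite /df; ring.
  exact: (@is_derive1_comp _ Phi (fun x => y / Num.sqrt x) x _ _ (is_derive_Phi _) dz).
have sx : s ^+ 2 <= x by rewrite (le_trans st).
have x0 : 0 < x by rewrite (lt_le_trans (exprn_gt0 2 s0)).
rewrite /df normrM normrN -[leRHS]mul1r ler_pM// ?x_std_pdf_le1//.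
have x20 : 0 < 2 * x by rewrite mulr_gt0.
rewrite gtr0_norm ?invr_gt0// lef_pV2 ?posrE ?exprn_gt0//.
by rewrite (le_trans sx)//; lra.
Qed.

(** The last trial is the innermost one, where heat_step applies and raises the
    time; since the bound of heat_step only uses a lower bound of the time, it
    serves for the other trials too. *)
Lemma binE_Psi s p n t y h : 0 < s -> s ^+ 2 <= t -> 0 <= p <= 1 -> 0 <= h ->
  `|binE p n (fun k => Psi t (y + k%:R * h))
    - Psi (t + n%:R * (p * (1 - p) * h ^+ 2)) (y + n%:R * p * h)|
  <= n%:R * (2 * h ^+ 3 / s ^+ 3).
Proof.
move=> s0 + p01 h0; have /andP[p0 p1] := p01.
elim: n t y => [|n IHn] t y st; first by rewrite binE0 !mul0r !addr0 subrr normr0.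
rewrite binE_recr.
set t' := t + p * (1 - p) * h ^+ 2.
have st' : s ^+ 2 <= t'.
  by rewrite (le_trans st)// lerDl mulr_ge0 ?sqr_ge0// mulr_ge0// subr_ge0.
have := IHn t' (y + p * h) st'.
have -> : t + n.+1%:R * (p * (1 - p) * h ^+ 2) = t' + n%:R * (p * (1 - p) * h ^+ 2).
  by rewrite /t' -natr1; ring.
have -> : y + n.+1%:R * p * h = y + p * h + n%:R * p * h by rewrite -natr1; ring.
set B := Psi _ _ => IH.
set A := binE _ _ _ in IH.
rewrite -(subrKA A) (le_trans (ler_normD _ _))// -[n.+1%:R]natr1 mulrDl mul1r addrC lerD//.
apply: (le_trans (binE_dist (e := fun=> 2 * h ^+ 3 / s ^+ 3) p01 _)); last by rewrite binE_cst.
move=> k _; rewrite /t'.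
have -> : y + k.+1%:R * h = y + p * h + k%:R * h + (1 - p) * h by rewrite -natr1; ring.
have -> : y + k%:R * h = y + p * h + k%:R * h - p * h by ring.
exact: heat_step.
Qed.

End heat.

(** * Majority-type functions *)

Section majority_function.
Context {R : realType}.
Variables (f : R -> R) (m : nat) (beta gamma : R).
Hypothesis hf : majority_type f m beta gamma.
Implicit Types (a b c t u x y : R).

Lemma majority_half : f 2^-1 = 2^-1.
Proof.
have h : 0 <= (2^-1 : R) <= 1 by apply/andP; split; lra.
have := majority_symmetric hf h.
have -> : 1 - 2^-1 = 2^-1 :> R by field.
by lra.
Qed.

(** The expansion at 0 gives the limit from the right, and differentiability
    relative to [0, 1] gives continuity there. *)
Lemma majority_0 : f 0 = 0.
Proof.
have lim0 : f x @[x --> (0 : R)^'+] --> 0.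
  have /eqO_exP[k k0 /= kx] := majority_expansion0 hf.
  apply/cvgr0Pnorm_le => e e0.
  pose D := k + beta.
  have D0 : 0 < D by rewrite addr_gt0// (majority_beta_gt0 hf).
  near=> x.
  have x0 : 0 < x by near: x; exact: nbhs_right_gt.
  have x1 : x <= 1 by near: x; exact: nbhs_right_le.
  have xe : x <= e / D by near: x; apply: nbhs_right_le; rewrite divr_gt0.
  have : `|f x - beta * x ^+ m| <= k * `|x ^+ m.+1| by near: x; exact: kx.
  rewrite (ger0_norm (exprn_ge0 _ (ltW x0))) => fx.
  have -> : f x = (f x - beta * x ^+ m) + beta * x ^+ m by rewrite subrK.
  rewrite (le_trans (ler_normD _ _))//.
  rewrite (ger0_norm (mulr_ge0 (ltW (majority_beta_gt0 hf)) (exprn_ge0 _ (ltW x0)))).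
  have xm n : (0 < n)%N -> x ^+ n <= x by case: n => // n _; rewrite exprS ler_piMr ?exprn_ile1// ltW.
  rewrite (@le_trans _ _ (k * x + beta * x))//.
    rewrite lerD//; first by rewrite (le_trans fx)// ler_pM2l// xm.
    rewrite ler_pM2l ?(majority_beta_gt0 hf)// xm//.
    by rewrite (leq_trans _ (majority_m_ge2 hf)).
  by rewrite -mulrDl mulrC -ler_pdivlMr.
have limf0 : f x @[x --> (0 : R)^'+] --> f 0.
  have [g [g0 gd _]] := majority_smooth hf.
  have A0 : (0 : R) \in `[0, 1]%classic by rewrite inE /= in_itv /= lexx ler01.
  have := gd 0%N isT 0 A0 => {}gd.
  have FA : (0 : R)^'+ `=>` within `[0, 1] (0 : R)^'.
    move=> S [e /= e0 eS]; near=> x.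
    have x0 : 0 < x by near: x; exact: nbhs_right_gt.
    have x1 : x <= 1 by near: x; exact: nbhs_right_le.
    apply: eS => /=; last 2 first.
    - by rewrite gt_eqF.
    - by rewrite in_itv /= x1 ltW.
    by rewrite sub0r normrN gtr0_norm//; near: x; exact: nbhs_right_lt.
  have {}gd : (g 0%N y - g 0%N 0) / (y - 0) @[y --> (0 : R)^'+] --> g 1%N 0.
    by apply: cvg_trans gd; apply: cvg_app.
  have idF : (fun y => y - 0) y @[y --> (0 : R)^'+] --> (0 : R).
    under eq_fun do rewrite subr0.
    exact: cvg_within.
  have gl : (g 0%N y - g 0%N 0) / (y - 0) * (y - 0) @[y --> (0 : R)^'+] --> g 1%N 0 * 0.
    exact: (cvgM gd idF).
  rewrite mulr0 in gl.
  have {}gl : g 0%N y @[y --> (0 : R)^'+] --> g 0%N 0.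
    apply/subr_cvg0; move: gl; apply: cvg_trans; apply: near_eq_cvg.
    near=> y; have y0 : 0 < y by near: y; exact: nbhs_right_gt.
    by rewrite divfK// subr0 gt_eqF.
  rewrite -g0//; move: gl; apply: cvg_trans; apply: near_eq_cvg.
  near=> y; rewrite g0// inE /= in_itv /=; apply/andP; split.
    by apply: ltW; near: y; exact: nbhs_right_gt.
  by near: y; exact: nbhs_right_le.
exact: (cvg_unique _ limf0 lim0).
Unshelve. all: by end_near. Qed.

Lemma majority_1 : f 1 = 1.
Proof.
have h : 0 <= (0 : R) <= 1 by rewrite lexx ler01.
by have := majority_symmetric hf h; rewrite majority_0 subr0; lra.
Qed.

(** Away from 0 the quotient by u^2 is bounded since f is. *)
Lemma majority_linear_bound : exists2 C, 0 <= C & forall u, `|u| <= 2^-1 ->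
  `|f (2^-1 + u) - (2^-1 + gamma * u)| <= C * u ^+ 2.
Proof.
have g1 := majority_gamma_gt1 hf.
have /eqO_exP[k k0 [e /= e0 ke]] := majority_expansion_half hf.
pose C := k + (1 + gamma) / e ^+ 2.
have C0 : 0 <= (1 + gamma) / e ^+ 2 by rewrite divr_ge0 ?sqr_ge0//; lra.
exists C => [|u uh]; first by rewrite addr_ge0// ltW.
have [ue|eu] := ltP `|u| e.
  have := ke u; rewrite /ball_ /= sub0r normrN => /(_ ue) /le_trans; apply.
  by rewrite ger0_norm ?sqr_ge0// ler_wpM2r ?sqr_ge0// lerDl.
apply: (@le_trans _ _ ((1 + gamma) / e ^+ 2 * u ^+ 2)); last first.
  by rewrite ler_wpM2r ?sqr_ge0// lerDr ltW.
apply: (@le_trans _ _ (1 + gamma)); last first.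
  rewrite mulrAC ler_pdivlMr ?exprn_gt0// ler_wpM2l//; first by lra.
  by rewrite -[u ^+ 2]ger0_norm ?sqr_ge0// normrX lerXn2r ?nnegrE// ltW.
move: uh; rewrite ler_norml => /andP[u1 u2].
have /(majority_range hf)/andP[f0 f1] : 0 <= 2^-1 + u <= 1 by apply/andP; split; lra.
have : `|gamma * u| <= gamma / 2.
  rewrite normrM gtr0_norm; last by lra.
  by rewrite ler_pM2l ?ler_norml ?u1//; lra.
by rewrite ler_norml => /andP[h1 h2]; rewrite ler_norml; apply/andP; split; lra.
Qed.

Lemma majority_convexE a b t : 0 <= a <= 2^-1 -> 0 <= b <= 2^-1 -> 0 <= t <= 1 ->
  f (t * a + (1 - t) * b) <= t * f a + (1 - t) * f b.
Proof.
move=> ha hb /andP[t0 t1].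
have /(_ a b) := majority_convex hf (Itv01 t0 t1).
by apply; rewrite inE /= in_itv.
Qed.

(** The function x - f x is concave on [0, 1/2], vanishes at both ends and is
    positive somewhere because gamma > 1; so it lies above the tent through one
    of its points, which dominates a multiple of x (1/2 - x). *)
Lemma majority_drift_left : exists2 c, 0 < c &
  forall x, 0 <= x <= 2^-1 -> f x <= x - c * (x * (2^-1 - x)).
Proof.
have g1 := majority_gamma_gt1 hf.
have [C C0 Cu] := majority_linear_bound.
have [h h0 [h4 Ch]] : exists2 h, 0 < h & h <= 4^-1 /\ C * h < gamma - 1.
  (* small enough for the quadratic error at 1/2 to stay below (gamma - 1) h *)
  exists ((gamma - 1) / (4 * (C + gamma))); first by rewrite divr_gt0 ?mulr_gt0//; lra.
  have D0 : 0 < 4 * (C + gamma) by rewrite mulr_gt0//; lra.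
  by split; [rewrite ler_pdivrMr//; lra|rewrite mulrA ltr_pdivrMr//; nra].
pose xs := 2^-1 - h.
have dlt : f xs < xs.
  have := Cu (- h); rewrite normrN gtr0_norm// => /(_ ltac:(lra)).
  rewrite sqrrN ler_norml => /andP[_]; rewrite -/xs mulrN => fx.
  have : C * h ^+ 2 < (gamma - 1) * h by rewrite expr2 mulrA ltr_pM2r.
  by rewrite /xs in fx *; lra.
have xs0 : 0 < xs by rewrite /xs; lra.
have xsh : xs < 2^-1 by rewrite /xs; lra.
exists (xs - f xs); first by rewrite subr_gt0.
set d := xs - f xs; have d0 : 0 < d by rewrite subr_gt0.
have fxs : f xs = xs - d by rewrite /d; ring.
clearbody d xs => x /andP[x0 xh].
have [xxs|xsx] := leP x xs.
  have := @majority_convexE xs 0 (x / xs).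
  rewrite mulr0 addr0 divfK ?gt_eqF// majority_0 mulr0 addr0 fxs.
  move=> /(_ ltac:(lra) ltac:(lra)).
  have tx : 0 <= x / xs <= 1 
    by apply/andP; split; [rewrite divr_ge0// ltW|rewrite ler_pdivrMr// mul1r].
  move=> /(_ tx) /le_trans; apply; rewrite mulrBr divfK ?gt_eqF// lerD2l lerN2.
  have -> : d * (x * (2^-1 - x)) = (x * d) * (2^-1 - x) by ring.
  have -> : x / xs * d = (x * d) * xs^-1 by ring.
  apply: ler_wpM2l; first by rewrite mulr_ge0// ltW.
  by rewrite (@le_trans _ _ 1)//; [lra|rewrite invf_ge1//; lra].
pose t := (2^-1 - x) / (2^-1 - xs).
have E0 : 2^-1 - xs != 0 by rewrite gt_eqF// subr_gt0.
have t01 : 0 <= t <= 1.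
  rewrite /t; apply/andP; split; first by rewrite divr_ge0 ?subr_ge0// ltW.
  by rewrite ler_pdivrMr ?subr_gt0// mul1r lerD2l lerN2 ltW.
have := @majority_convexE xs 2^-1 t; rewrite majority_half fxs.
move=> /(_ ltac:(lra) ltac:(lra) t01).
have tE : t * (2^-1 - xs) = 2^-1 - x by rewrite /t divfK.
have -> : t * xs + (1 - t) * 2^-1 = x.
  have -> : t * xs + (1 - t) * 2^-1 = 2^-1 - t * (2^-1 - xs) by ring.
  by rewrite tE; ring.
move=> /le_trans; apply.
have -> : t * (xs - d) + (1 - t) / 2 = x - d * t.
  have -> : t * (xs - d) + (1 - t) / 2 = 2^-1 - t * (2^-1 - xs) - d * t by ring.
  by rewrite tE; ring.
rewrite lerD2l lerN2 ler_pM2l// /t mulrC; apply: ler_wpM2l; first by rewrite subr_ge0.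
by rewrite (@le_trans _ _ 1)//; [lra|rewrite invf_ge1 ?subr_gt0//; lra].
Qed.

Lemma majority_drift : exists2 c, 0 < c &
  forall u, 0 <= u <= 2^-1 -> u + c * (u * (2^-1 - u)) <= f (2^-1 + u) - 2^-1.
Proof.
have [c c0 cx] := majority_drift_left; exists c => // u /andP[u0 uh].
have xh : 0 <= 2^-1 - u <= 2^-1 by apply/andP; split; lra.
have xr : 0 <= 2^-1 - u <= 1 by apply/andP; split; lra.
have := majority_symmetric hf xr; have := cx _ xh.
have -> : 1 - (2^-1 - u) = 2^-1 + u by field.
have -> : 2^-1 - (2^-1 - u) = u by ring.
rewrite (mulrC u); lra.
Qed.

End majority_function.

(** * The barrier and the transition operator *)

Section barrier.
Context {R : realType}.
Implicit Types (A w m : R).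

(** The truncation min(1, A / w^2), continued by 1 to w <= 0: a Lyapunov
    function that decreases as the majority of w > 0 gets clearer. *)
Definition barrier A w : R := if (0 < w) && (A < w ^+ 2) then A / w ^+ 2 else 1.

Lemma barrier_ge0 A w : 0 <= A -> 0 <= barrier A w.
Proof. by move=> A0; rewrite /barrier; case: ifP => // _; rewrite divr_ge0 ?sqr_ge0. Qed.

Lemma barrier_le1 A w : 0 <= A -> barrier A w <= 1.
Proof.
move=> A0; rewrite /barrier; case: ifP => // /andP[w0 Aw].
by rewrite ler_pdivrMr ?exprn_gt0// mul1r ltW.
Qed.

Lemma barrier_le_inv A w : 0 < w -> barrier A w <= A / w ^+ 2.
Proof.
move=> w0; rewrite /barrier w0 /=; case: ltP => // wA.
by rewrite ler_pdivlMr ?exprn_gt0// mul1r.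
Qed.

(** A majorant whose expectation only involves mean and variance: for
    w >= m / 2 it comes from the expansion of 1 / w^2 at m, and otherwise the
    term 4 (w - m)^2 / m^2 alone exceeds 1, as in Chebyshev's inequality. *)
Lemma barrier_quad A w m : 0 <= A -> 0 < m ->
  barrier A w <= A / m ^+ 2 - 2 * A / m ^+ 3 * (w - m)
    + (8 * A / m ^+ 4 + 4 / m ^+ 2) * (w - m) ^+ 2.
Proof.
move=> A0 m0; have m1 := ltW m0; have mn : m != 0 by rewrite gt_eqF.
have [mw|wm] := leP m (2 * w).
  have w0 : 0 < w by lra.
  have wn : w != 0 by rewrite gt_eqF.
  apply: (le_trans (barrier_le_inv _ w0)).
  rewrite -subr_ge0.
  have -> : A / m ^+ 2 - 2 * A / m ^+ 3 * (w - m)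
    + (8 * A / m ^+ 4 + 4 / m ^+ 2) * (w - m) ^+ 2 - A / w ^+ 2 =
    4 / m ^+ 2 * (w - m) ^+ 2
    + A * (w - m) ^+ 2 / (m ^+ 4 * w ^+ 2) * (8 * w ^+ 2 - m * (2 * w + m)).
    by field; rewrite wn.
  apply: addr_ge0; first by rewrite mulr_ge0 ?divr_ge0 ?sqr_ge0.
  apply: mulr_ge0.
    by rewrite divr_ge0// mulr_ge0 ?sqr_ge0// exprn_ge0.
  have -> : 8 * w ^+ 2 - m * (2 * w + m) = (2 * w - m) * (4 * w + m) by ring.
  by rewrite mulr_ge0//; lra.
apply: (le_trans (barrier_le1 _ A0)).
have h1 : 1 <= 4 / m ^+ 2 * (w - m) ^+ 2.
  rewrite mulrAC ler_pdivlMr ?exprn_gt0// mul1r.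
  rewrite -subr_ge0.
  have -> : 4 * (w - m) ^+ 2 - m ^+ 2 = (m - 2 * w) * (3 * m - 2 * w) by ring.
  by rewrite mulr_ge0//; lra.
have h2 : 0 <= A / m ^+ 2 by rewrite divr_ge0 ?sqr_ge0.
have h3 : 0 <= - (2 * A / m ^+ 3 * (w - m)).
  rewrite -mulrN; apply: mulr_ge0; last by lra.
  by rewrite divr_ge0 ?exprn_ge0// mulr_ge0.
have h4 : 0 <= 8 * A / m ^+ 4 * (w - m) ^+ 2.
  by rewrite mulr_ge0 ?sqr_ge0// divr_ge0 ?exprn_ge0// mulr_ge0.
by rewrite mulrDl; lra.
Qed.

End barrier.

Section transition.
Context {R : realType}.
Variables (n : nat) (f : R -> R).
Implicit Types (g : R -> R) (x : R).

(** The states are real numbers since the initial state need not be an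
    integer; after one round they are. *)
Definition trans g x : R := binE (f (x / n%:R)) n (fun k => g k%:R).

Hypothesis n0 : (0 < n)%N.
Hypothesis f01 : forall x, 0 <= x <= 1 -> 0 <= f x <= 1.

Let ratio01 x : 0 <= x <= n%:R -> 0 <= x / n%:R <= 1.
Proof.
move=> /andP[x0 xn]; rewrite divr_ge0//= ler_pdivrMr ?mul1r//.
by rewrite ltr0n.
Qed.

Let success01 x : 0 <= x <= n%:R -> 0 <= f (x / n%:R) <= 1.
Proof. by move=> /ratio01/f01. Qed.

Let state01 k : (k <= n)%N -> 0 <= (k%:R : R) <= n%:R.
Proof. by move=> kn; rewrite ler0n ler_nat. Qed.

Lemma ler_trans g g' x : 0 <= x <= n%:R ->
  (forall y, 0 <= y <= n%:R -> g y <= g' y) -> trans g x <= trans g' x.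
Proof. by move=> /success01 fx gg'; apply: ler_binE => // k /state01/gg'. Qed.

Lemma ler_iter_trans t g g' x : 0 <= x <= n%:R ->
  (forall y, 0 <= y <= n%:R -> g y <= g' y) ->
  iter t trans g x <= iter t trans g' x.
Proof.
by move=> + gg'; elim: t x => [|t IHt] x xn /=; [exact: gg'|exact: ler_trans].
Qed.

Lemma iter_trans_supermartingale s t g x : 0 <= x <= n%:R -> (s <= t)%N ->
  (forall y, 0 <= y <= n%:R -> trans g y <= g y) ->
  iter t trans g x <= iter s trans g x.
Proof.
move=> xn st gsup; rewrite -(subnKC st) iterD; apply: ler_iter_trans => // y.
elim: (t - s)%N y => // r IHr y yn /=.
by apply: le_trans (gsup _ yn); exact: ler_trans.
Qed.

Lemma iter_transB t a g x :
  iter t trans (fun y => a - g y) x = a - iter t trans g x.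
Proof.
elim: t x => //= t IHt x; rewrite /trans.
under eq_binE => k _ do rewrite IHt.
rewrite binED binE_cst; congr (_ + _); rewrite -mulN1r -binEZ.
by apply: eq_binE => k _; rewrite mulN1r.
Qed.

Lemma trans_dist e g g' x : 0 <= x <= n%:R ->
  (forall y, 0 <= y <= n%:R -> `|g y - g' y| <= e y) ->
  `|trans g x - trans g' x| <= trans e x.
Proof. by move=> /success01 fx gg'; apply: binE_dist => // k /state01/gg'. Qed.

Lemma iter_trans_reflect t g x : 0 <= x <= n%:R ->
  (forall y, 0 <= y <= 1 -> 1 - f (1 - y) = f y) ->
  iter t trans (fun y => g (n%:R - y)) x = iter t trans g (n%:R - x).
Proof.
move=> + fsym; elim: t x => // t IHt x xn /=; rewrite /trans.
have -> : f ((n%:R - x) / n%:R) = 1 - f (x / n%:R).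
  rewrite -[in RHS]fsym ?ratio01// subKr mulrBl divff//.
  by rewrite pnatr_eq0 -lt0n.
rewrite binE_reflect; apply: eq_binE => k kn.
by rewrite IHt ?state01// natrB.
Qed.

End transition.

Section scaling.
Context {R : realType}.
Implicit Types (x c : R).

Definition centre n x : R := (x - n%:R / 2) / Num.sqrt n%:R.

Lemma natr_sqrt n : (0 < n)%N ->
  exists2 r : R, 0 < r & n%:R = r ^+ 2 /\ Num.sqrt n%:R = r.
Proof.
move=> n0; exists (Num.sqrt n%:R); first by rewrite sqrtr_gt0 ltr0n.
by rewrite sqr_sqrtr.
Qed.

Lemma centreE n x : (0 < n)%N ->
  centre n x = Num.sqrt n%:R * (x / n%:R - 2^-1).
Proof.
move=> n0; have [r r0 [rE sE]] := natr_sqrt n0.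
by rewrite /centre sE rE; field; rewrite gt_eqF.
Qed.

(** Mean and variance of one round in the scaled coordinate. *)
Lemma trans_quad n (f : R -> R) x a b c : (0 < n)%N ->
  let M := Num.sqrt n%:R * (f (x / n%:R) - 2^-1) in
  trans n f (fun y => a + b * (centre n y - M) + c * (centre n y - M) ^+ 2) x
  = a + c * (f (x / n%:R) * (1 - f (x / n%:R))).
Proof.
move=> n0; cbv zeta; rewrite /trans; set p := f _.
have [r r0 [rE sE]] := natr_sqrt n0.
have rn : r != 0 by rewrite gt_eqF.
rewrite /centre sE.
transitivity (binE p n (fun k =>
    (a - b * r * p + c * r ^+ 2 * p ^+ 2)
    + (b / r - 2 * c * p) * k%:R + c / r ^+ 2 * k%:R ^+ 2)).
  by apply: eq_binE => k _; rewrite rE; field.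
by rewrite binE_quad rE; field.
Qed.

End scaling.

(** * Bounds on the transition operator *)

Section extinction.
Context {R : realType}.
Variables (f : R -> R) (m : nat) (beta gamma : R).
Hypothesis hf : majority_type f m beta gamma.
Implicit Types (x c A d e : R).

(** By barrier_quad with m the mean after one round, the claim reduces to
    12 u^2 (1/4 - F^2) <= A (F^2 - u^2), where u = x / n - 1/2 and
    F = f (x / n) - 1/2. It does not mention n, and follows from the drift
    F - u >= c u (1/2 - u) with A = 6 / c. *)
Lemma barrier_supermartingale : exists2 A, 0 < A &
  forall n x, (0 < n)%N -> 0 <= x <= n%:R ->
  trans n f (fun y => barrier A (centre n y)) x <= barrier A (centre n x).
Proof.
have [c c0 drift] := majority_drift hf.
exists (6 / c) => [|n x n0 /andP[x0 xn]]; first by rewrite divr_gt0.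
set A := 6 / c; have A0 : 0 < A by rewrite divr_gt0.
have cA : A * c = 6 by rewrite divfK// gt_eqF.
clearbody A.
have nR0 : 0 < n%:R :> R by rewrite ltr0n.
have x1 : 0 <= x / n%:R <= 1.
  by rewrite divr_ge0//= ler_pdivrMr// mul1r.
have p01 := majority_range hf x1.
rewrite [leRHS]/barrier; case: ifP => [/andP[W0 AW]|_]; last first.
  by apply: binE_le => // k _; apply: barrier_le1; exact: ltW.
have [r r0 [rE sE]] := natr_sqrt (R := R) n0.
set W := centre n x in W0 AW *.
set u := x / n%:R - 2^-1.
have WE : W = r * u by rewrite /W centreE// sE.
have u0 : 0 < u by move: W0; rewrite WE pmulr_rgt0.
have uh : u <= 2^-1 by rewrite /u; lra.
have := drift u; rewrite /u addrCA subrr addr0 -/u => /(_ _).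
have -> : 0 <= u <= 2^-1 by rewrite uh ltW.
move=> /(_ isT); set p := f (x / n%:R) in p01 *; set F := p - 2^-1 => uF.
have uF' : u <= F.
  apply: le_trans uF; rewrite lerDl.
  by rewrite (mulr_ge0 (ltW c0))// (mulr_ge0 (ltW u0))// subr_ge0.
have F0 : 0 < F by exact: lt_le_trans uF'.
have M0 : 0 < r * F by rewrite mulr_gt0.
have WM : W <= r * F by rewrite WE ler_pM2l.
have AM : A <= (r * F) ^+ 2.
  by rewrite (le_trans (ltW AW))// lerXn2r ?nnegrE// ltW.
apply: (@le_trans _ _ (trans n f (fun y => A / (r * F) ^+ 2
   + (- (2 * A / (r * F) ^+ 3)) * (centre n y - r * F)
   + (8 * A / (r * F) ^+ 4 + 4 / (r * F) ^+ 2) * (centre n y - r * F) ^+ 2) x)).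
  apply: ler_binE => // k _.
  apply: (le_trans (barrier_quad _ (ltW A0) M0)).
  by rewrite mulNr.
have := trans_quad f x (A / (r * F) ^+ 2) (- (2 * A / (r * F) ^+ 3))
  (8 * A / (r * F) ^+ 4 + 4 / (r * F) ^+ 2) n0.
cbv zeta; rewrite sE -/p -/F => ->.
have pq : p * (1 - p) = 4^-1 - F ^+ 2 by rewrite /F; field.
have pq0 : 0 <= 4^-1 - F ^+ 2 by rewrite -pq mulr_ge0 ?subr_ge0//; case/andP: p01.
rewrite pq.
apply: (@le_trans _ _ ((A + 12 * (4^-1 - F ^+ 2)) / (r * F) ^+ 2)).
  rewrite [leRHS]mulrDl lerD2l [leRHS]mulrAC; apply: ler_wpM2r => //.
  have -> : 12 / (r * F) ^+ 2 = 8 / (r * F) ^+ 2 + 4 / (r * F) ^+ 2 by ring.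
  rewrite lerD2r.
  have -> : 8 * A / (r * F) ^+ 4 = 8 * A / (r * F) ^+ 2 / (r * F) ^+ 2.
    by field; rewrite !gt_eqF.
  rewrite ler_pM2r ?invr_gt0 ?exprn_gt0//.
  by rewrite ler_pdivrMr ?exprn_gt0// ler_pM2l.
rewrite ler_pdivrMr ?exprn_gt0// mulrAC ler_pdivlMr ?exprn_gt0// WE.
rewrite !exprMn [leLHS]mulrCA [leRHS]mulrCA; apply: ler_wpM2l; first exact: sqr_ge0.
rewrite mulrDl -lerBrDl -mulrBr.
apply: (@le_trans _ _ (12 * u ^+ 2 * (2^-1 - u))).
  rewrite mulrAC; apply: ler_wpM2l; first by rewrite mulr_ge0 ?sqr_ge0.
  have : u ^+ 2 <= F ^+ 2 by rewrite lerXn2r ?nnegrE// ltW.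
  have : 0 <= (2^-1 - u) ^+ 2 by exact: sqr_ge0.
  by rewrite sqrrB; lra.
have -> : 12 * u ^+ 2 * (2^-1 - u) = A * (c * (u * (2^-1 - u))) * (2 * u).
  transitivity (A * c * (u * (2^-1 - u)) * (2 * u)); last by ring.
  by rewrite cA; ring.
rewrite subr_sqr [leRHS]mulrA; apply: ler_pM.
- by rewrite (mulr_ge0 (ltW A0))// (mulr_ge0 (ltW c0))// (mulr_ge0 (ltW u0))// subr_ge0.
- by rewrite mulr_ge0// ltW.
- by apply: ler_wpM2l; [exact: ltW|rewrite lerBrDl].
- by lra.
Qed.

Variable sigma : R.
Hypothesis sigma0 : 0 < sigma.
Hypothesis sigmaE : sigma ^+ 2 * (gamma ^+ 2 - 1) = 4^-1.

(** One round acts on these profiles, up to a small error, by c |-> c / gamma. *)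
Definition normal_profile n c x := Psi (sigma ^+ 2) (centre n x + c).

Let gamma1 : 1 < gamma := majority_gamma_gt1 hf.
Let gamma0 : 0 < gamma. Proof. exact: lt_trans gamma1. Qed.

(** This is where the variance of Z comes from: adding the noise 1/4 to
    sigma^2 multiplies it by gamma^2. *)
Lemma Psi_rescale y : Psi (sigma ^+ 2 + 4^-1) (gamma * y) = Psi (sigma ^+ 2) y.
Proof.
rewrite -sigmaE /Psi.
have -> : sigma ^+ 2 + sigma ^+ 2 * (gamma ^+ 2 - 1) = (gamma * sigma) ^+ 2 by ring.
rewrite !sqrtr_sqr !gtr0_norm ?mulr_gt0//.
by congr Phi; field; rewrite !gt_eqF.
Qed.

(** The error has three parts: Lindeberg's replacement, the deviation F^2 of
    the variance of a trial from 1/4, and the nonlinearity of f at 1/2. The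
    last two are quadratic in w, so the second moment of w must be kept under
    control along the iteration, and the second conclusion does that. *)
Lemma trans_normal_profile_bound : exists2 K, 0 <= K & forall n x, (0 < n)%N -> 0 <= x <= n%:R ->
  [/\ forall c, `|trans n f (normal_profile n c) x - normal_profile n (c / gamma) x|
        <= K * (1 + centre n x ^+ 2) / Num.sqrt n%:R &
      trans n f (fun y => 1 + centre n y ^+ 2) x <= (1 + K) * (1 + centre n x ^+ 2)].
Proof.
have [C C0 linear] := majority_linear_bound hf.
set G := (gamma + C) ^+ 2.
have G0 : 0 <= G by exact: sqr_ge0.
set K := 2 / sigma ^+ 3 + G / sigma ^+ 2 + C / sigma + G.
have s2 := exprn_gt0 2 sigma0; have s3 := exprn_gt0 3 sigma0.
have K1 : 0 <= 2 / sigma ^+ 3 by rewrite divr_ge0// ltW.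
have K2 : 0 <= G / sigma ^+ 2 by rewrite divr_ge0// ltW.
have K3 : 0 <= C / sigma by rewrite divr_ge0// ltW.
exists K => [|n x n0 /andP[x0 xn]]; first by rewrite /K; lra.
have nR0 : 0 < n%:R :> R by rewrite ltr0n.
have x1 : 0 <= x / n%:R <= 1.
  by rewrite divr_ge0//= ler_pdivrMr// mul1r.
have p01 := majority_range hf x1.
have [r r0 [rE sE]] := natr_sqrt (R := R) n0.
have r1 : 1 <= r.
  by rewrite -sE -[leLHS]sqrtr1 ler_wsqrtr// ler1n.
have rn : r != 0 by rewrite gt_eqF.
set W := centre n x.
set u := x / n%:R - 2^-1.
have WE : W = r * u by rewrite /W centreE// sE.
have uh : `|u| <= 2^-1 by rewrite ler_norml /u; apply/andP; split; lra.
have := linear u uh; rewrite /u addrCA subrr addr0 -/u.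
set p := f (x / n%:R) in p01 *.
have [F FE] : exists F, F = p - 2^-1 by eexists.
have -> : p - (2^-1 + gamma * u) = F - gamma * u by rewrite FE; ring.
move=> Fu.
have pq : p * (1 - p) = 4^-1 - F ^+ 2 by rewrite FE; field.
have pq0 : 0 <= 4^-1 - F ^+ 2 by rewrite -pq mulr_ge0 ?subr_ge0//; case/andP: p01.
have FG : F ^+ 2 <= G * u ^+ 2.
  have : `|F| <= (gamma + C) * `|u|.
    have -> : F = (F - gamma * u) + gamma * u by rewrite subrK.
    rewrite (le_trans (ler_normD _ _))// mulrDl addrC lerD//.
      by rewrite normrM gtr0_norm.
    apply: (le_trans Fu); apply: ler_wpM2l => //.
    rewrite -[u ^+ 2]ger0_norm ?sqr_ge0// normrX expr2 ler_piMr//.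
    by rewrite (le_trans uh)//; lra.
  move=> h; rewrite /G -exprMn -[F ^+ 2]ger0_norm ?sqr_ge0// normrX.
  rewrite -[((gamma + C) * u) ^+ 2]ger0_norm ?sqr_ge0// normrX normrM.
  rewrite (ger0_norm (_ : 0 <= gamma + C)); last by rewrite addr_ge0// ltW.
  by rewrite lerXn2r ?nnegrE// mulr_ge0// addr_ge0// ltW.
have W20 : 0 <= W ^+ 2 by exact: sqr_ge0.
split=> [c|].
  have h0 : 0 <= r^-1 by rewrite invr_ge0 ltW.
  have E1 : trans n f (normal_profile n c) x =
      binE p n (fun k => Psi (sigma ^+ 2) (c - r / 2 + k%:R * r^-1)).
    apply: eq_binE => k _; rewrite /normal_profile /centre sE rE; congr Psi.
    by field.
  have := binE_Psi n (c - r / 2) sigma0 (lexx _) p01 h0.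
  rewrite -E1.
  have -> : n%:R * (p * (1 - p) * r^-1 ^+ 2) = 4^-1 - F ^+ 2.
    by rewrite pq rE; field.
  have -> : c - r / 2 + n%:R * p * r^-1 = c + r * F by rewrite rE FE; field.
  have -> : n%:R * (2 * r^-1 ^+ 3 / sigma ^+ 3) = 2 / sigma ^+ 3 / r.
    by rewrite rE; field; rewrite rn gt_eqF.
  move=> H1.
  have H2 : `|Psi (sigma ^+ 2 + (4^-1 - F ^+ 2)) (c + r * F)
              - Psi (sigma ^+ 2 + 4^-1) (c + r * F)| <= G / sigma ^+ 2 * W ^+ 2 / r.
    apply: (le_trans (Psi_time_lipschitz _ sigma0 _ _)).
    - by rewrite lerDl.
    - by rewrite lerDl.
    have -> : sigma ^+ 2 + (4^-1 - F ^+ 2) - (sigma ^+ 2 + 4^-1) = - F ^+ 2 by ring.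
    rewrite normrN ger0_norm ?sqr_ge0//.
    rewrite [leRHS](_ : _ = G * W ^+ 2 / r / sigma ^+ 2); last by ring.
    apply: ler_wpM2r; first by rewrite invr_ge0 ltW.
    apply: (le_trans FG); rewrite -mulrA; apply: ler_wpM2l => //.
    rewrite WE exprMn.
    have -> : r ^+ 2 * u ^+ 2 / r = r * u ^+ 2 by field.
    by rewrite ler_peMl// sqr_ge0.
  have H3 : `|Psi (sigma ^+ 2 + 4^-1) (c + r * F) - Psi (sigma ^+ 2 + 4^-1) (gamma * (W + c / gamma))|
      <= C / sigma * W ^+ 2 / r.
    apply: (le_trans (Psi_lipschitz _ _ sigma0 _)); first by rewrite lerDl.
    rewrite [leRHS](_ : _ = C * W ^+ 2 / r / sigma); last by ring.
    apply: ler_wpM2r; first by rewrite invr_ge0 ltW.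
    have -> : c + r * F - gamma * (W + c / gamma) = r * (F - gamma * u).
      by rewrite WE; field; rewrite gt_eqF.
    rewrite normrM gtr0_norm//.
    rewrite [leRHS](_ : _ = r * (C * u ^+ 2)); last by rewrite WE; field.
    by rewrite ler_pM2l.
  rewrite Psi_rescale in H3.
  rewrite sE -/(centre n x) -/W /normal_profile -/W.
  set a := trans _ _ _ _ in H1 *; set b1 := Psi _ _ in H1 H2 *.
  set b2 := Psi _ _ in H2 H3 *; set b3 := Psi _ _ in H3 *.
  have -> : a - b3 = (a - b1) + (b1 - b2) + (b2 - b3) by ring.
  apply: (le_trans (ler_normD _ _)).
  apply: (@le_trans _ _ (2 / sigma ^+ 3 / r + G / sigma ^+ 2 * W ^+ 2 / r + C / sigma * W ^+ 2 / r)).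
    by apply: lerD => //; apply: (le_trans (ler_normD _ _)); exact: lerD.
  rewrite -!mulrDl; apply: ler_wpM2r => //.
  have := mulr_ge0 K1 W20; have := mulr_ge0 G0 W20; clear -K1 K2 K3 G0 W20.
  rewrite /K; move: (2 / _) (G / _) (C / _) (W ^+ 2) K1 K2 K3 W20 => k1 k2 k3 w.
  clearbody G; by lra.
set M := r * F.
have -> : trans n f (fun y => 1 + centre n y ^+ 2) x = 1 + M ^+ 2 + (4^-1 - F ^+ 2).
  have := trans_quad f x (1 + M ^+ 2) (2 * M) 1 n0; cbv zeta.
  rewrite sE -/p -FE -/M pq mul1r => <-.
  by apply: eq_binE => k _; ring.
have MG : M ^+ 2 <= G * W ^+ 2.
  by rewrite /M WE !exprMn [leRHS]mulrCA; apply: ler_wpM2l; first exact: sqr_ge0.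
have G1 : 1 <= G by rewrite /G exprn_ege1// (le_trans (ltW gamma1))// lerDl.
apply: (@le_trans _ _ (1 + G + G * W ^+ 2)); first by have := sqr_ge0 F; lra.
have GK : G <= K by rewrite /K lerDr !addr_ge0.
have : G * W ^+ 2 <= K * W ^+ 2 by exact: ler_wpM2r.
by clearbody K G; lra.
Qed.

(** The errors of the successive rounds add up; the powers of 1 + K come from
    the growth of the second moment of w between them. *)
Lemma iter_trans_normal_profile : exists2 K, 0 <= K & forall n s x c, (0 < n)%N -> 0 <= x <= n%:R ->
  `|iter s (trans n f) (normal_profile n c) x - normal_profile n (c / gamma ^+ s) x|
  <= s%:R * K * (1 + K) ^+ s / Num.sqrt n%:R * (1 + centre n x ^+ 2).
Proof.
have [K K0 HK] := trans_normal_profile_bound; exists K => // n s x c n0.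
have f01 := majority_range hf.
have r0 : 0 <= (Num.sqrt n%:R)^-1 :> R by rewrite invr_ge0 sqrtr_ge0.
have L1 : 1 <= 1 + K by rewrite lerDl.
have L0 : 0 <= 1 + K by rewrite addr_ge0.
elim: s x => [|s IHs] x xn.
  by rewrite /= expr0 divr1 subrr normr0 !mul0r.
have [HK1 HK2] := HK n x n0 xn.
set a := s%:R * K * (1 + K) ^+ s / Num.sqrt n%:R in IHs.
have a0 : 0 <= a by rewrite /a mulr_ge0 ?mulr_ge0 ?exprn_ge0.
set W2 := 1 + centre n x ^+ 2 in HK1 HK2 *.
have W20 : 0 <= W2 by rewrite /W2 addr_ge0 ?sqr_ge0.
rewrite iterS.
set g := normal_profile n (c / gamma ^+ s) in IHs.
have -> : c / gamma ^+ s.+1 = c / gamma ^+ s / gamma.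
  by rewrite exprSr invfM mulrA.
rewrite -(subrKA (trans n f g x)) (le_trans (ler_normD _ _))//.
apply: (@le_trans _ _ (a * ((1 + K) * W2) + K * W2 / Num.sqrt n%:R)).
  apply: lerD; last exact: HK1.
  apply: (@le_trans _ _ (trans n f (fun y => a * (1 + centre n y ^+ 2)) x)).
    by apply: trans_dist.
  by rewrite /trans binEZ; apply: ler_wpM2l.
rewrite /a -natr1 exprSr.
have L : 1 <= (1 + K) ^+ s * (1 + K) by rewrite -exprSr exprn_ege1.
set E := (1 + K) ^+ s * (1 + K) in L *.
have -> : s%:R * K * (1 + K) ^+ s / Num.sqrt n%:R * ((1 + K) * W2) + K * W2 / Num.sqrt n%:R
  = (s%:R * K * E + K) * (W2 / Num.sqrt n%:R) by rewrite /E; ring.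
have -> : (s%:R + 1) * K * E / Num.sqrt n%:R * W2 =
   (s%:R * K * E + K * E) * (W2 / Num.sqrt n%:R) by ring.
apply: ler_wpM2r; first by rewrite mulr_ge0.
by rewrite lerD2l ler_peMr.
Qed.

(** With A / K^2 = e the barrier is at most e above K, and for c much larger
    than K the shifted profile is at most e below K. *)
Lemma barrier_le_normal_profile A e : 0 < A -> 0 < e -> exists2 c, 0 <= c &
  forall w, barrier A w <= 1 + e - Psi (sigma ^+ 2) (w - c).
Proof.
move=> A0 e0; have [K' PK] := Phi_small e0.
pose K := Num.sqrt (A / e).
have K0 : 0 < K by rewrite sqrtr_gt0 divr_gt0.
exists (K + sigma * `|K'|) => [|w].
  by rewrite addr_ge0 ?mulr_ge0// ltW.
rewrite /Psi sqrtr_sqr (gtr0_norm sigma0).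
have [wK|Kw] := leP w K.
  apply: (@le_trans _ _ 1); first exact/barrier_le1/ltW.
  rewrite -addrA lerDl subr_ge0; apply: le_trans PK; apply: Phi_nondecreasing.
  have : sigma * K' <= sigma * `|K'| by rewrite ler_pM2l// ler_norm.
  by rewrite ler_pdivrMr//; lra.
have w0 : 0 < w by exact: lt_trans Kw.
apply: (@le_trans _ _ e).
  apply: (le_trans (barrier_le_inv _ w0)).
  rewrite ler_pdivrMr ?exprn_gt0// mulrC -ler_pdivrMr//.
  rewrite -[A / e]sqr_sqrtr; last by rewrite divr_ge0// ltW.
  by rewrite lerXn2r ?nnegrE// ltW.
have := Phi_le1 ((w - (K + sigma * `|K'|)) / sigma).
by lra.
Qed.

(** The shift c fixed by the error e is divided by gamma at each round, so it is
    negligible after s rounds; then n is taken large with s fixed. *)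
Lemma extinction_bound d (x0 : nat -> R) :
  (forall n, (0 < n)%N -> 0 <= x0 n <= n%:R) ->
  centre n (x0 n) @[n --> \oo] --> d ->
  forall e, 0 < e -> exists s, \forall n \near \oo, forall t, (s <= t)%N ->
  iter t (trans n f) (fun y => (y == 0)%:R) (x0 n) <= 1 - Phi (d / sigma) + e.
Proof.
move=> x0n x0d e e0.
have f01 := majority_range hf.
have [A A0 super] := barrier_supermartingale.
have [K K0 HK] := iter_trans_normal_profile.
pose e4 := e / 4; have e40 : 0 < e4 by rewrite divr_gt0.
have [c c0 Hc] := barrier_le_normal_profile A0 e40.
have [s Hs] : exists s, c / gamma ^+ s / sigma <= e4.
  have : c / sigma * (gamma^-1) ^+ s @[s --> \oo] --> c / sigma * 0.
    apply: cvgM; first exact: cvg_cst.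
    by apply: cvg_expr; rewrite ger0_norm ?invf_lt1// invr_ge0 ltW.
  rewrite mulr0 => /cvgr0_norm_le /(_ e4 e40) [s _ /(_ s (leqnn _)) /=].
  rewrite ger0_norm; last first.
    by rewrite mulr_ge0 ?exprn_ge0 ?divr_ge0 ?invr_ge0// ltW.
  by exists s; rewrite mulrAC -exprVn.
exists s.
pose B := s%:R * K * (1 + K) ^+ s * (1 + (`|d| + 1) ^+ 2).
have B0 : 0 <= B.
  by rewrite /B !mulr_ge0 ?exprn_ge0 ?addr_ge0 ?sqr_ge0.
have sqrt_large : \forall n \near \oo, B / e4 <= Num.sqrt (n%:R : R).
  near=> n.
  rewrite -[B / e4]ger0_norm; last by rewrite divr_ge0// ltW.
  rewrite -sqrtr_sqr ler_wsqrtr//; near: n; exact: nbhs_infty_ger.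
near=> n => t st.
have n0 : (0 < n)%N by near: n; exact: nbhs_infty_gt.
have xn := x0n n n0.
have near1 : `|centre n (x0 n) - d| <= 1.
  by near: n; move/cvgrPdistC_le : x0d; apply.
have near2 : `|centre n (x0 n) - d| <= sigma * e4.
  by near: n; move/cvgrPdistC_le : x0d; apply; rewrite mulr_gt0.
set W := centre n (x0 n) in near1 near2.
apply: (@le_trans _ _ (iter t (trans n f) (fun y => barrier A (centre n y)) (x0 n))).
  apply: ler_iter_trans => // y /andP[y0 yn].
  have [->|_] := eqVneq y 0; last by apply: barrier_ge0; exact: ltW.
  rewrite /barrier /centre sub0r mulNr oppr_gt0 ltNge.
  by rewrite (_ : 0 <= _) ?divr_ge0 ?sqrtr_ge0.
apply: (le_trans (iter_trans_supermartingale n0 f01 xn st _)) => //.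
  by move=> y yn; exact: super.
apply: (@le_trans _ _ (iter s (trans n f) (fun y => 1 + e4 - normal_profile n (- c) y) (x0 n))).
  by apply: ler_iter_trans => // y _; exact: Hc.
rewrite iter_transB.
have := HK n s (x0 n) (- c) n0 xn.
rewrite ler_norml => /andP[lower _].
have err : s%:R * K * (1 + K) ^+ s / Num.sqrt n%:R * (1 + centre n (x0 n) ^+ 2) <= e4.
  apply: (@le_trans _ _ (B / Num.sqrt n%:R)).
    rewrite /B mulrAC; apply: ler_wpM2r; first by rewrite invr_ge0 sqrtr_ge0.
    apply: ler_wpM2l; first by rewrite !mulr_ge0 ?exprn_ge0// addr_ge0.
    rewrite lerD2l -[W ^+ 2]ger0_norm ?sqr_ge0// normrX lerXn2r ?nnegrE ?addr_ge0//.
    by rewrite -[W](subrK d) addrC (le_trans (ler_normD _ _))// lerD2l.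
  rewrite ler_pdivrMr; last by rewrite sqrtr_gt0 ltr0n.
  rewrite mulrC -ler_pdivrMr//; near: n; exact: sqrt_large.
have smooth : Phi (d / sigma) - e4 - e4 <= normal_profile n (- c / gamma ^+ s) (x0 n).
  have : `|Phi (d / sigma) - normal_profile n (- c / gamma ^+ s) (x0 n)| <= e4 + e4.
    rewrite /normal_profile /Psi sqrtr_sqr (gtr0_norm sigma0).
    apply: (le_trans (Phi_lipschitz _ _)).
    rewrite -mulrBl -/W.
    have -> : (d - (W + - c / gamma ^+ s)) / sigma = (d - W) / sigma + c / gamma ^+ s / sigma by ring.
    rewrite (le_trans (ler_normD _ _))// lerD//.
      rewrite normrM normfV (gtr0_norm sigma0) ler_pdivrMr// (mulrC e4).
      by rewrite distrC.
    by rewrite ger0_norm// divr_ge0 ?(ltW sigma0)// divr_ge0// exprn_ge0// ltW.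
  by rewrite ler_norml => /andP[]; lra.
have -> : e = e4 + e4 + e4 + e4 by rewrite /e4; field.
lra.
Unshelve. all: by end_near. Qed.

End extinction.

(** * Laws of the chain *)

Section real_probability.
Context d (T : measurableType d) (R : realType) (P : probability T R).
Implicit Types (A B C : set T).

Definition pr A : R := fine (P A).

Lemma prE A : measurable A -> P A = (pr A)%:E.
Proof. by move=> mA; rewrite /pr fineK// fin_num_measure. Qed.

Lemma pr_ge0 A : 0 <= pr A.
Proof. by rewrite /pr fine_ge0. Qed.

Lemma pr_le A B : measurable A -> measurable B -> A `<=` B -> pr A <= pr B.
Proof. by move=> mA mB AB; rewrite -lee_fin -!prE// le_measure ?inE. Qed.

Lemma pr_split A B : measurable A -> measurable B ->
  pr A = pr (A `&` B) + pr (A `\` B).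
Proof.
move=> mA mB; have mAB := measurableI _ _ mA mB; have mAB' := measurableD mA mB.
apply: EFin_inj; rewrite EFinD -!prE// addrC.
by rewrite [in LHS](measureDI P mA mB).
Qed.

Lemma pr_null_setI A B : measurable A -> measurable B -> pr A = 0 -> pr (A `&` B) = 0.
Proof.
move=> mA mB A0; apply/eqP; rewrite eq_le pr_ge0 andbT -A0.
by apply: pr_le => //; exact: measurableI.
Qed.

Lemma measurable_eq (Y : {RV P >-> R}) (y : R) : measurable [set w | Y w = y].
Proof.
have -> : [set w | Y w = y] = Y @^-1` [set y] by [].
by rewrite -[_ @^-1` _]setTI; apply: measurable_funPT.
Qed.

(** The induction on N needs the last event to be measurable, whence the second
    conclusion. *)
Lemma pr_decompose (Y : {RV P >-> R}) N C : measurable C ->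
  pr C = \sum_(j < N) pr (C `&` [set w | Y w = j%:R])
       + pr (C `&` [set w | forall j, (j < N)%N -> Y w <> j%:R])
  /\ measurable [set w | forall j, (j < N)%N -> Y w <> j%:R].
Proof.
move=> mC; elim: N => [|N [IHN mN]].
  have -> : [set w | forall j, (j < 0)%N -> Y w <> j%:R] = setT.
    by rewrite -subTset => w _ j.
  by rewrite big_ord0 add0r setIT.
have E : [set w | forall j, (j < N.+1)%N -> Y w <> j%:R] =
  [set w | forall j, (j < N)%N -> Y w <> j%:R] `\` [set w | Y w = N%:R].
  apply/seteqP; split=> w /=.
    by move=> h; split; [move=> j jN; apply: h; exact: ltnW|apply: h].
  move=> [h1 h2] j; rewrite ltnS leq_eqVlt => /orP[/eqP -> //|]; exact: h1.
have mE := measurable_eq Y N%:R.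
rewrite E; split; last exact: measurableD.
rewrite IHN big_ord_recr /= -addrA; congr (_ + _).
have mCN := measurableI _ _ mC mN.
rewrite (pr_split mCN mE) setIDA; congr (_ + _); congr pr.
apply/seteqP; split=> w /=; first by move=> [[]].
by move=> [h1 h2]; split=> //; split=> // j jN; rewrite h2 => /eqP; rewrite eqr_nat gtn_eqF.
Qed.

(** The mass of C sits on the values 0, ..., N - 1 of Y, hence so does that of
    every subset of C. *)
Lemma pr_total (Y : {RV P >-> R}) N C B : measurable C -> measurable B ->
  pr C = \sum_(j < N) pr (C `&` [set w | Y w = j%:R]) ->
  pr (C `&` B) = \sum_(j < N) pr (C `&` [set w | Y w = j%:R] `&` B).
Proof.
move=> mC mB h; have [hC mN] := pr_decompose Y N mC.
have [hCB _] := pr_decompose Y N (measurableI _ _ mC mB).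
rewrite hCB [X in _ + X](_ : _ = 0) ?addr0.
  by apply: eq_bigr => j _; rewrite setIAC.
rewrite setIAC; apply: pr_null_setI => //; first exact: measurableI.
by move: hC; rewrite h => /eqP; rewrite -subr_eq0 opprD addNKr oppr_eq0 => /eqP.
Qed.

End real_probability.

Section chain.
Context d (T : measurableType d) (R : realType) (P : probability T R).
Variables (n : nat) (f : R -> R) (x0 : R) (X : nat -> {RV P >-> R}).
Hypothesis n0 : (0 < n)%N.
Hypothesis f01 : forall x, 0 <= x <= 1 -> 0 <= f x <= 1.
Hypothesis x0n : 0 <= x0 <= n%:R.
Hypothesis hX : binomial_chain n f x0 X.
Implicit Types (x : nat -> R) (y : R).

Let path s x : set T := [set w | forall r, (r <= s)%N -> X r w = x r].

Let extend s x j : nat -> R := fun r => if (r <= s)%N then x r else j%:R.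

Lemma binomial_prob_set1 (p : R) k : 0 <= p <= 1 ->
  binomial_prob n p [set k] = (binomial_pmf n p k)%:E.
Proof.
by move=> p01; rewrite /binomial_prob p01 esum_set1// lee_fin binomial_pmf_ge0.
Qed.

Let pathS s x j : path s x `&` [set w | X s.+1 w = j%:R] = path s.+1 (extend s x j).
Proof.
apply/seteqP; split=> w /=.
  move=> [h1 h2] r; rewrite leq_eqVlt => /orP[/eqP ->|].
    by rewrite /extend ltnn.
  by rewrite ltnS => rs; rewrite /extend rs; exact: h1.
move=> h; split; first by move=> r rs; rewrite h ?leqW// /extend rs.
by rewrite h// /extend ltnn.
Qed.

Let path0 x : path 0 x = [set w | X 0 w = x 0].
Proof.
apply/seteqP; split=> w /=; first by apply.
by move=> h r; rewrite leqn0 => /eqP ->.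
Qed.

Let measurable_path s x : measurable (path s x).
Proof.
elim: s => [|s IHs]; first by rewrite path0; exact: measurable_eq.
have -> : path s.+1 x = path s x `&` [set w | X s.+1 w = x s.+1].
  apply/seteqP; split=> w /=.
    by move=> h; split; [move=> r rs; apply: h; exact: leqW|apply: h].
  by move=> [h1 h2] r; rewrite leq_eqVlt => /orP[/eqP ->//|]; rewrite ltnS; exact: h1.
by apply: measurableI => //; exact: measurable_eq.
Qed.

Let success x s : 0 <= x s <= n%:R -> 0 <= f (x s / n%:R) <= 1.
Proof.
move=> /andP[h0 hn]; apply: f01; rewrite divr_ge0//= ler_pdivrMr ?mul1r//.
by rewrite ltr0n.
Qed.

Let path_step s x k : 0 <= x s <= n%:R ->
  pr P (path s x `&` [set w | X s.+1 w = k%:R])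
  = pr P (path s x) * binomial_pmf n (f (x s / n%:R)) k.
Proof.
move=> xs; have [_ h] := hX; apply: EFin_inj.
have mX := measurable_eq (X s.+1) k%:R.
rewrite -prE; last exact: measurableI.
by rewrite EFinM -(prE _ (measurable_path s x)) -binomial_prob_set1 ?success// -h.
Qed.

Let path_total s x B : 0 <= x s <= n%:R -> measurable B ->
  pr P (path s x `&` B) =
  \sum_(j < n.+1) pr P (path s.+1 (extend s x j) `&` B).
Proof.
move=> xs mB; rewrite (@pr_total _ _ _ _ (X s.+1) n.+1)//.
  by apply: eq_bigr => j _; rewrite pathS.
under eq_bigr do rewrite path_step//.
rewrite -mulr_sumr -[LHS]mulr1; congr (_ * _).
rewrite -[LHS](binE_cst (f (x s / n%:R)) n); apply: eq_bigr => j _.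
by rewrite mulr1.
Qed.

Let extend_state s x j : (j <= n)%N -> 0 <= extend s x j s.+1 <= n%:R.
Proof. by move=> jn; rewrite /extend ltnn ler0n ler_nat. Qed.

(** Conditioning on the next state; each path with its last state in [0, n] is
    extended by the integers 0, ..., n, which carry all its mass. *)
Let path_iter r s x k : 0 <= x s <= n%:R ->
  pr P (path s x `&` [set w | X (s + r)%N w = k])
  = pr P (path s x) * iter r (trans n f) (fun y => (y == k)%:R) (x s).
Proof.
elim: r s x => [|r IHr] s x xs.
  rewrite addn0 /=; have [<-|xk] := eqVneq (x s) k.
    rewrite mulr1; congr pr; apply/seteqP; split=> w /=; first by case.
    by move=> h; split=> //; exact: h.
  rewrite mulr0 -[RHS](_ : pr P set0 = 0); last by rewrite /pr measure0.
  congr pr; rewrite -subset0 => w /= [/(_ s (leqnn _)) -> /eqP].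
  by rewrite (negbTE xk).
rewrite path_total//; last exact: measurable_eq.
rewrite iterS /trans /binE mulr_sumr; apply: eq_bigr => j _.
rewrite -addSnnS IHr; last by apply: extend_state; rewrite -ltnS.
by rewrite -pathS path_step// -mulrA /extend ltnn.
Qed.

(** The Markov property at a later time is obtained by the same extension of
    paths, since the chain is only described through its paths from time 0. *)
Let path_iter2 a r s x y k : 0 <= x s <= n%:R ->
  pr P (path s x `&` ([set w | X (s + a)%N w = y] `&` [set w | X (s + a + r)%N w = k]))
  = pr P (path s x `&` [set w | X (s + a)%N w = y])
    * iter r (trans n f) (fun y => (y == k)%:R) y.
Proof.
have mE t z := measurable_eq (X t) z.
elim: a s x => [|a IHa] s x xs.
  rewrite !addn0; have [<-|xy] := eqVneq (x s) y.
    have E : path s x `&` [set w | X s w = x s] = path s x.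
      apply/seteqP; split=> w /=; first by case.
      by move=> h; split=> //; exact: h.
    by rewrite setIA E path_iter.
  have E : path s x `&` [set w | X s w = y] = set0.
    rewrite -subset0 => w /= [/(_ s (leqnn _)) -> /eqP].
    by rewrite (negbTE xy).
  by rewrite setIA E set0I /pr measure0 mul0r.
rewrite !path_total//; last exact: measurableI.
rewrite mulr_suml; apply: eq_bigr => j _.
by rewrite -addSnnS IHa//; apply: extend_state; rewrite -ltnS.
Qed.

Let pr_start B : measurable B -> pr P (path 0 (fun=> x0) `&` B) = pr P B.
Proof.
move=> mB; have m0 := measurable_path 0 (fun=> x0).
rewrite [RHS](pr_split P mB m0) setIC [X in _ + X](_ : _ = 0) ?addr0//.
have h1 : pr P (path 0 (fun=> x0)) = 1 by rewrite path0 /pr hX.1.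
apply/eqP; rewrite eq_le pr_ge0 andbT.
have := pr_split P measurableT m0; rewrite setTI h1.
have -> : pr P setT = 1 by rewrite /pr probability_setT.
move=> hD; have {}hD : pr P (setT `\` path 0 (fun=> x0)) = 0 by lra.
rewrite -hD; apply: pr_le; [exact: measurableD|exact: measurableD|].
by apply: setSD.
Qed.

Lemma chain_law t k :
  pr P [set w | X t w = k] = iter t (trans n f) (fun y => (y == k)%:R) x0.
Proof.
have := @path_iter t 0%N (fun=> x0) k x0n.
rewrite add0n pr_start; last exact: measurable_eq.
by move=> ->; rewrite path0 {1}/pr hX.1 /= mul1r.
Qed.

Lemma chain_markov a r y k :
  pr P ([set w | X a w = y] `&` [set w | X (a + r)%N w = k])
  = pr P [set w | X a w = y] * iter r (trans n f) (fun y => (y == k)%:R) y.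
Proof.
have mE t z := measurable_eq (X t) z.
have := @path_iter2 a r 0%N (fun=> x0) y k x0n.
by rewrite add0n !pr_start//; exact: measurableI.
Qed.

End chain.

(** * Absorption and domination *)

Section absorption.
Context {R : realType}.
Variables (n : nat) (f : R -> R).
Hypothesis n0 : (0 < n)%N.
Hypothesis f01 : forall x, 0 <= x <= 1 -> 0 <= f x <= 1.
Hypotheses (f0 : f 0 = 0) (f1 : f 1 = 1).
Implicit Types (g : R -> R).

Lemma iter_trans_0 t g : iter t (trans n f) g 0 = g 0.
Proof. by elim: t => //= t IHt; rewrite /trans mul0r f0 binE_p0. Qed.

Lemma iter_trans_n t g : iter t (trans n f) g n%:R = g n%:R.
Proof.
by elim: t => //= t IHt; rewrite /trans divff ?f1 ?binE_p1// pnatr_eq0 -lt0n.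
Qed.

Definition unabsorbed (z : R) : R := 1 - ((z == 0)%:R + (z == n%:R)%:R).

Lemma trans_unabsorbed y : 0 <= y <= n%:R ->
  trans n f unabsorbed y <= (1 - 2^-1 ^+ n) * unabsorbed y.
Proof.
move=> /andP[y0 yn].
have nR0 : 0 < n%:R :> R by rewrite ltr0n.
have g0 : unabsorbed 0 = 0 by rewrite /unabsorbed eqxx lt_eqF//= addr0 subrr.
have gn : unabsorbed n%:R = 0 by rewrite /unabsorbed eqxx gt_eqF//= add0r subrr.
have [->|y_neq0] := eqVneq y 0.
  by rewrite (iter_trans_0 1 unabsorbed : trans n f _ 0 = _) g0 mulr0.
have [->|y_neqn] := eqVneq y n%:R.
  by rewrite (iter_trans_n 1 unabsorbed : trans n f _ _ = _) gn mulr0.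
have -> : unabsorbed y = 1.
  by rewrite /unabsorbed (negbTE y_neq0) (negbTE y_neqn) addr0 subr0.
have -> : trans n f unabsorbed y = 1 - trans n f (fun z => (z == 0)%:R + (z == n%:R)%:R) y.
  exact: (@iter_transB R n f 1%N 1 (fun z => (z == 0)%:R + (z == n%:R)%:R) y).
rewrite mulr1 lerD2l lerN2.
have p01 : 0 <= f (y / n%:R) <= 1.
  by apply: f01; rewrite divr_ge0//= ler_pdivrMr// mul1r.
apply: (le_trans (binomial_pmf_extreme n p01)).
rewrite /= /trans binED; apply: lerD; rewrite /binE.
  rewrite (bigD1 ord0)//= eqxx mulr1 lerDl; apply: sumr_ge0 => k _.
  by rewrite mulr_ge0// binomial_pmf_ge0.
rewrite (bigD1 ord_max)//= eqxx mulr1 lerDl; apply: sumr_ge0 => k _.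
by rewrite mulr_ge0// binomial_pmf_ge0.
Qed.

Lemma iter_trans_unabsorbed t y : 0 <= y <= n%:R ->
  1 - (1 - 2^-1 ^+ n) ^+ t <=
  iter t (trans n f) (fun z => (z == 0)%:R) y
  + iter t (trans n f) (fun z => (z == n%:R)%:R) y.
Proof.
move=> yn.
have iterD' : iter t (trans n f) (fun z => (z == 0)%:R + (z == n%:R)%:R) y =
  iter t (trans n f) (fun z => (z == 0)%:R) y
  + iter t (trans n f) (fun z => (z == n%:R)%:R) y.
  clear yn; elim: t y => //= t IHt y; rewrite /trans -binED.
  by apply: eq_binE => k _; rewrite IHt.
rewrite -iterD' lerBlDl -lerBlDr -(@iter_transB R n f).
have rho0 : 0 <= 1 - 2^-1 ^+ n :> R.
  by rewrite subr_ge0 exprn_ile1// ?invr_ge0// invf_le1// ler1n.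
have g1 z : unabsorbed z <= 1 by rewrite /unabsorbed lerBlDr lerDl addr_ge0.
suff H z : 0 <= z <= n%:R -> iter t (trans n f) unabsorbed z <= (1 - 2^-1 ^+ n) ^+ t * unabsorbed z.
  by apply: (le_trans (H _ yn)); rewrite ler_piMr// exprn_ge0.
clear iterD'; elim: t z => [|t IHt] z zn; first by rewrite expr0 mul1r.
rewrite iterS.
apply: (@le_trans _ _ (trans n f (fun z => (1 - 2^-1 ^+ n) ^+ t * unabsorbed z) z)).
  exact: ler_trans.
rewrite /trans binEZ exprSr -mulrA; apply: ler_wpM2l; first exact: exprn_ge0.
exact: trans_unabsorbed.
Qed.

End absorption.

Section domination.
Context d (T : measurableType d) (R : realType) (P : probability T R).
Variables (n : nat) (f : R -> R) (x0 : R) (X : nat -> {RV P >-> R}).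

Lemma dominatingE o : dominating n (fun t => X t : T -> R) o =
  \bigcup_t [set w | X t w = match o with OpX => n%:R | OpY => 0 end].
Proof.
apply/seteqP; split=> w /=.
  move=> [t]; case: o => /= h; exists t => //=.
  by move: h => /eqP; rewrite subr_eq addrC -subr_eq subrr => /eqP.
by move=> [t _]; case: o => /= h; exists t => //=; rewrite h subr0.
Qed.

Lemma measurable_dominating o : measurable (dominating n (fun t => X t : T -> R) o).
Proof. by rewrite dominatingE; apply: bigcup_measurable => t _; exact: measurable_eq. Qed.

Hypothesis n0 : (0 < n)%N.
Hypothesis f01 : forall x, 0 <= x <= 1 -> 0 <= f x <= 1.
Hypotheses (f0 : f 0 = 0) (f1 : f 1 = 1).
Hypothesis x0n : 0 <= x0 <= n%:R.
Hypothesis hX : binomial_chain n f x0 X.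

Let nR0 : 0 < n%:R :> R. Proof. by rewrite ltr0n. Qed.

Let D o := dominating n (fun t => X t : T -> R) o.

(** As f 0 = 0 and f 1 = 1, the states 0 and n are absorbing, so that a path
    through one of them almost surely never visits the other one. *)
Lemma dominating_disjoint : pr P (D OpX `&` D OpY) = 0.
Proof.
have mE t z := measurable_eq (X t) z.
have null s t : P.-negligible ([set w | X s w = n%:R] `&` [set w | X t w = 0]).
  have mI := measurableI _ _ (mE s n%:R) (mE t 0).
  apply/negligibleP => //; apply: (etrans (prE P mI)).
  congr EFin; case/orP: (leq_total s t) => [st|ts].
    have := chain_markov n0 f01 x0n hX s (t - s) n%:R 0.
    by rewrite subnKC// iter_trans_n// gt_eqF//= mulr0.
  rewrite setIC; have := chain_markov n0 f01 x0n hX t (s - t) 0 n%:R.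
  by rewrite subnKC// iter_trans_0// lt_eqF//= mulr0.
have : P.-negligible (D OpX `&` D OpY).
  rewrite /D !dominatingE setI_bigcupl; apply: negligible_bigcup => s.
  by rewrite setI_bigcupr; apply: negligible_bigcup => t.
move/negligibleP => h; rewrite /pr h//.
by apply: measurableI; exact: measurable_dominating.
Qed.

Lemma dominating_sum_le1 : pr P (D OpX) + pr P (D OpY) <= 1.
Proof.
have mX := measurable_dominating OpX; have mY := measurable_dominating OpY.
rewrite (pr_split P mX mY) dominating_disjoint add0r.
have := pr_split P measurableT mY; rewrite setTI.
have -> : pr P setT = 1 by rewrite /pr probability_setT.
move=> ->; rewrite addrC lerD2l; apply: pr_le; [exact: measurableD|exact: measurableD|].
exact: setSD.
Qed.

(** By time t the chain has left o unsuccessful only if it is unabsorbed, which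
    has probability at most (1 - 2^-n)^t, or sits at the opposite end. *)
Lemma dominating_lower o a s :
  (forall t, (s <= t)%N -> pr P [set w | X t w = match o with OpX => 0 | OpY => n%:R end] <= a) ->
  1 - a <= pr P (D o).
Proof.
move=> ha; pose rho : R := 1 - 2^-1 ^+ n.
have rho01 : 0 <= rho < 1.
  rewrite /rho ltrBlDr ltrDl exprn_gt0 ?invr_gt0// andbT.
  by rewrite subr_ge0 exprn_ile1// ?invr_ge0// invf_le1// ler1n.
have key t : (s <= t)%N -> 1 - a - pr P (D o) <= rho ^+ t.
  move=> st; have := iter_trans_unabsorbed n0 f01 f0 f1 t x0n.
  rewrite -!(chain_law n0 f01 x0n hX).
  have := ha t st.
  have : pr P [set w | X t w = match o with OpX => n%:R | OpY => 0 end] <= pr P (D o).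
    apply: pr_le; [exact: measurable_eq|exact: measurable_dominating|].
    by rewrite /D dominatingE => w h; exists t.
  by rewrite -/rho; case: o {ha}; lra.
rewrite -subr_le0; apply/ler_addgt0Pr => e e0; rewrite add0r.
have : rho ^+ t @[t --> \oo] --> 0.
  by apply: cvg_expr; rewrite ger0_norm; case/andP: rho01.
move=> /cvgr0_norm_le /(_ e e0)[N _ /(_ (maxn s N) (leq_maxr _ _))] /=.
rewrite ger0_norm; last by rewrite exprn_ge0//; case/andP: rho01.
by apply: le_trans; apply: key; exact: leq_maxl.
Qed.

End domination.

(** * The limit theorem *)

Section limit.
Context {R : realType}.

Lemma cvg_centre (d : R) (x0 : nat -> R) :
  (fun n => x0 n - (n%:R / 2 + d * Num.sqrt n%:R) : R^o)
    =o_\oo (fun n => Num.sqrt n%:R : R^o) ->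
  centre n (x0 n) @[n --> \oo] --> d.
Proof.
move=> /eqoP h; apply/cvgrPdistC_le => e e0.
near=> n.
have n0 : (0 < n)%N by near: n; exact: nbhs_infty_gt.
have r0 : 0 < Num.sqrt n%:R :> R by rewrite sqrtr_gt0 ltr0n.
have : `|x0 n - (n%:R / 2 + d * Num.sqrt n%:R)| <= e * `|Num.sqrt n%:R|.
  by near: n; exact: (h e e0).
rewrite (gtr0_norm r0) -ler_pdivrMr// => hn.
have -> : centre n (x0 n) - d = (x0 n - (n%:R / 2 + d * Num.sqrt n%:R)) / Num.sqrt n%:R.
  by rewrite /centre; field; rewrite gt_eqF.
by rewrite normf_div (gtr0_norm r0).
Unshelve. all: by end_near. Qed.

Lemma centre_reflect n (x : R) : centre n (n%:R - x) = - centre n x.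
Proof. by rewrite /centre -[RHS]mulNr; congr (_ / _); field. Qed.

End limit.

Unset Implicit Arguments.

Theorem theorem1p2 (R : realType) (d : R)
    (f : R -> R) (m : nat) (beta gamma : R)
    (hf : majority_type f m beta gamma)
    (x0 : nat -> R)
    (hx0 : forall n : nat, (0 < n)%N -> 0 <= x0 n <= n%:R)
    (hx0_asymp :
       (fun n => x0 n - (n%:R / 2 + d * Num.sqrt n%:R) : R^o)
         =o_\oo (fun n => Num.sqrt n%:R : R^o))
    (disp : nat -> measure_display)
    (T : forall n : nat, measurableType (disp n))
    (P : forall n : nat, probability (T n) R)
    (X : forall n : nat, nat -> {RV (P n) >-> R})
    (hX : forall n : nat, (0 < n)%N -> binomial_chain n f (x0 n) (X n))
    (dispZ : measure_display) (TZ : measurableType dispZ)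
    (PZ : probability TZ R) (Z : {RV PZ >-> R})
    (hZ : forall A : set R, measurable A ->
       distribution PZ Z A
       = normal_prob d (Num.sqrt (4 * (gamma ^+ 2 - 1))^-1) A) :
  (P n (dominating n (X n) OpX) @[n --> \oo] --> PZ [set w | 0 <= Z w])
  /\ (P n (dominating n (X n) OpY) @[n --> \oo] --> PZ [set w | Z w <= 0]).
Proof.
have f01 := majority_range hf.
have f0 := majority_0 hf; have f1 := majority_1 hf.
have fsym := majority_symmetric hf.
have g1 := majority_gamma_gt1 hf.
have g2 : 0 < 4 * (gamma ^+ 2 - 1).
  by rewrite mulr_gt0// subr_gt0 exprn_egt1.
set sigma := Num.sqrt (4 * (gamma ^+ 2 - 1))^-1 in hZ.
have sigma0 : 0 < sigma by rewrite sqrtr_gt0 invr_gt0.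
have sigmaE : sigma ^+ 2 * (gamma ^+ 2 - 1) = 4^-1.
  rewrite sqr_sqrtr; last by rewrite invr_ge0 ltW.
  by rewrite invfM -mulrA mulVf ?mulr1// gt_eqF// subr_gt0 exprn_egt1.
clearbody sigma.
have -> : PZ [set w | 0 <= Z w] = (Phi (d / sigma))%:E.
  have -> : [set w | 0 <= Z w] = Z @^-1` `[0, +oo[.
    by apply/seteqP; split=> w /=; rewrite in_itv /= andbT.
  by rewrite -normal_prob_ge0// -hZ.
have -> : PZ [set w | Z w <= 0] = (1 - Phi (d / sigma))%:E.
  have -> : [set w | Z w <= 0] = Z @^-1` `]-oo, 0].
    by apply/seteqP; split=> w /=; rewrite in_itv.
  by rewrite -normal_prob_le0// -hZ.
have c0 := cvg_centre hx0_asymp.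
have x0r n : (0 < n)%N -> 0 <= n%:R - x0 n <= n%:R.
  by move=> /hx0/andP[h1 h2]; rewrite subr_ge0 h2 lerBlDr lerDl.
have c0r : centre n (n%:R - x0 n) @[n --> \oo] --> - d.
  by under eq_fun do rewrite centre_reflect; exact: cvgN.
pose D n o := dominating n (X n) o.
have bound e : 0 < e -> \forall n \near \oo,
    Phi (d / sigma) - e <= pr (P n) (D n OpX) /\
    1 - Phi (d / sigma) - e <= pr (P n) (D n OpY).
  move=> e0.
  have [s Hs] := extinction_bound hf sigma0 sigmaE hx0 c0 e0.
  (* the reflected chain, with the roles of the opinions exchanged *)
  have [s' Hs'] := extinction_bound hf sigma0 sigmaE x0r c0r e0.
  near=> n.
  have n0 : (0 < n)%N by near: n; exact: nbhs_infty_gt.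
  have xn := hx0 n n0; have xc := hX n n0.
  have Hn : forall t, (s <= t)%N ->
      iter t (trans n f) (fun y => (y == 0)%:R) (x0 n) <= 1 - Phi (d / sigma) + e.
    by near: n; exact: Hs.
  have Hn' : forall t, (s' <= t)%N ->
      iter t (trans n f) (fun y => (y == 0)%:R) (n%:R - x0 n) <= 1 - Phi (- d / sigma) + e.
    by near: n; exact: Hs'.
  split.
    have -> : Phi (d / sigma) - e = 1 - (1 - Phi (d / sigma) + e) by ring.
    apply: (dominating_lower n0 f01 f0 f1 xn xc (o := OpX) (s := s)) => t st.
    by rewrite (chain_law n0 f01 xn xc); exact: Hn.
  have -> : 1 - Phi (d / sigma) - e = 1 - (1 - Phi (- d / sigma) + e).
    by rewrite mulNr Phi_opp; ring.
  apply: (dominating_lower n0 f01 f0 f1 xn xc (o := OpY) (s := s')) => t st.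
  rewrite (chain_law n0 f01 xn xc); apply: le_trans (Hn' t st).
  rewrite -(iter_trans_reflect n0 t _ xn fsym).
  rewrite le_eqVlt; apply/orP; left; apply/eqP.
  congr (iter t _ _ _); apply/funext => y.
  by rewrite subr_eq0 eq_sym.
have finite o : \forall n \near \oo, P n (D n o) \is a fin_num.
  by near=> n; rewrite fin_num_measure//; exact: measurable_dominating.
split; apply/fine_cvgP; split; try exact: finite.
  apply/cvgrPdist_le => e e0; near=> n.
  have n0 : (0 < n)%N by near: n; exact: nbhs_infty_gt.
  have [h1 h2] : Phi (d / sigma) - e <= pr (P n) (D n OpX) /\
    1 - Phi (d / sigma) - e <= pr (P n) (D n OpY) by near: n; exact: bound.
  have h3 := dominating_sum_le1 n0 f01 f0 f1 (hx0 n n0) (hX n n0).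
  rewrite ler_norml; apply/andP; rewrite -/(pr (P n) _) /=.
  by move: h1 h2 h3; rewrite /D /pr /=; split; lra.
apply/cvgrPdist_le => e e0; near=> n.
have n0 : (0 < n)%N by near: n; exact: nbhs_infty_gt.
have [h1 h2] : Phi (d / sigma) - e <= pr (P n) (D n OpX) /\
  1 - Phi (d / sigma) - e <= pr (P n) (D n OpY) by near: n; exact: bound.
have h3 := dominating_sum_le1 n0 f01 f0 f1 (hx0 n n0) (hX n n0).
rewrite ler_norml; apply/andP.
by move: h1 h2 h3; rewrite /D /pr /=; split; lra.
Unshelve. all: by end_near. Qed.
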